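(* Let $K$ be a field, let $\sigma,\tau\in\mathrm{Aut}(K)$, and let $M$ be an indecomposable twisted Gelfand-Ponomarev module over $K[F,V]_{\sigma,\tau}$. Then $M$ is either of the first kind or of the second kind. (i) If $M$ is of the first kind, there exists a connected linear Kraft quiver $\Gamma$, unique up to isomorphism, such that $M\simeq M(\Gamma,\mathbf 1_\Gamma)$. (ii) If $M$ is of the second kind, there exist a connected circular Kraft quiver $\Gamma$ with no repetitions and a strict indecomposable $(\sigma,\tau)$-linear representation $(U,\rho)$ of $\Gamma$ such that $M\simeq M(\Gamma,U,\rho)$. The datum $(\Gamma,U,\rho)$ is unique up to isomorphism.
   Context: Twisted modules. $K[F,V]_{\sigma,\tau}$ is the $K$-algebra generated by $F,V$ subject to $FV=VF=0$, $F\lambda=\sigma(\lambda)F$, $V\lambda=\tau(\lambda)V$ for $\lambda\in K$. A twisted Gelfand-Ponomarev module is a left $K[F,V]_{\sigma,\tau}$-module of finite dimension over $K$. It is indecomposable if it is non-zero and is not the direct sum of two proper submodules. Graphs. A finite directed graph labeled by $\{F,V\}$ consists of a finite set $\mathcal V$ of vertices and a set $\mathcal E\subseteq\mathcal V\times\mathcal V\times\{F,V\}$ of arrows; the arrow $(v_1,v_2,\ell)$ has tail $v_1$, head $v_2$ and label $\ell$ (loops are allowed, and an $F$-arrow and a $V$-arrow may share the same tail and head). An isomorphism of such graphs is a bijection on vertices inducing a label-preserving bijection on arrows. Connectedness refers to the underlying undirected graph. A Kraft quiver is such a graph for which: (1) each vertex is the tail or the head of at most $2$ arrows; (2) two distinct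 arrows with the same label have distinct heads and distinct tails; (3) the head of any $F$-arrow is not the tail of any $V$-arrow, and the tail of any $F$-arrow is not the head of any $V$-arrow. The converse graph $\Gamma^{\#}$ is obtained by reversing all $V$-arrows and relabeling them $V^{\#}$; $\mathcal E^{\#}$ is its set of arrows, with label function $\mathrm{label}^{\#}$. A non-empty connected Kraft quiver with $n$ vertices is linear if its vertices can be ordered $v_1,\dots,v_n$ so that $\mathcal E^{\#}$ consists exactly of one arrow $v_i\to v_{i+1}$ for each $1\le i\le n-1$; it is circular if its vertices can be ordered $v_i$, $i\in\mathbb Z/n\mathbb Z$, so that $\mathcal E^{\#}$ consists exactly of one arrow $E_i:v_i\to v_{i+1}$ for each $i\in\mathbb Z/n\mathbb Z$. A connected circular Kraft quiver has repetitions if there is $1\le m<n$ dividing $n$ with $\mathrm{label}^{\#}(E_i)=\mathrm{label}^{\#}(E_{i+m})$ for all $i$; otherwise it has no repetitions. Representations. A $(\sigma,\tau)$-linear representation $(U,\rho)$ of $\Gamma$ is a family of finite dimensional $K$-vector spaces $U_v$ and maps $\rho_E:U_{v_1}\to U_{v_2}$ for each arrow $E$ with tail $v_1$ and head $v_2$, $\sigma$-linear if $E$ is an $F$-arrow and $\tau$-linear if $E$ is a $V$-arrow. It is strict if every $\rho_E$ is bijective; it is indecomposable if it is non-zero and not isomorphic to a direct sum of two non-zero representations. Isomorphisms of representations are families of $K$-linear isomorphisms $U_v\to U'_v$ commuting with the $\rho_E,\rho_E'$; an isomorphism $(\Gamma,U,\rho)\simeq(\Gamma',U',\rho')$ is an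 isomorphism of labeled graphs under which $(U,\rho)$ is isomorphic to $(U',\rho')$. The trivial representation $\mathbf 1_\Gamma$ has $U_v=K$ for all $v$, $\rho_E=\sigma$ for $F$-arrows, $\rho_E=\tau$ for $V$-arrows. The module $M(\Gamma,U,\rho)=\bigoplus_v U_v$ has $F$ (resp. $V$) acting on $U_v$ as the sum of the $\rho_E$ over the $F$-arrows (resp. $V$-arrows) $E$ with tail $v$ (zero if there are none). First and second kind. Let $M$ be a twisted Gelfand-Ponomarev module. A word is a finite sequence $w=w_m\cdots w_1$ ($m\ge0$) of letters in $\{F,V^{\#}\}$; $W$ is the monoid of words under concatenation. For relations $B_1,B_2\subseteq M\times M$ put $B_2B_1=\{(x,z):\exists y,\ (x,y)\in B_1,(y,z)\in B_2\}$, $\mathrm{Dom}(B)=\{x:\exists y,(x,y)\in B\}$, $\mathrm{Ker}(B)=\{x:(x,0)\in B\}$. Put $D(F)=\{(x,Fx):x\in M\}$, $D(V^{\#})=\{(Vy,y):y\in M\}$, $D(w)=D(w_m)\cdots D(w_1)$, and $D(\emptyset)$ the identity relation. The stabilized sequence $\mathcal F_M=\{\mathrm{Ker}\,D(w):w\in W\}\cup\{\mathrm{Dom}\,D(w):w\in W\}$ is a finite chain of subspaces $\{0\}=\beta_0\subsetneq\beta_1\subsetneq\cdots\subsetneq\beta_s=M$; the pairs $(\beta_i,\beta_{i+1})$, $0\le i\le s-1$, are the elementary intervals of $M$. Let $W_1=\{w\in W:\mathrm{Dom}\,D(V^{\#}w)\subsetneq\mathrm{Ker}\,D(Fw)\}$.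 An elementary interval is of the first kind if it equals $(\mathrm{Dom}\,D(V^{\#}w),\mathrm{Ker}\,D(Fw))$ for some $w\in W_1$, and of the second kind otherwise. $M$ is of the first (resp. second) kind if all its elementary intervals are of the first (resp. second) kind. *)

(* Defs.v *)
From HB Require Import structures.
From mathcomp Require Import all_boot all_order all_algebra.

Set Implicit Arguments.
Unset Strict Implicit.
Unset Printing Implicit Defensive.

Import GRing.Theory.
Local Open Scope ring_scope.

Section DirectSum.

Context {K : fieldType} {I : finType} (U : I -> vectType K).

(* The library only has the non-dependent case {ffun I -> U}. *)
Definition dsum : Type := {dffun forall i : I, U i}.

HB.instance Definition _ := Choice.on dsum.

Definition dsum_of (g : forall i : I, U i) : dsum :=
  [ffun i => g i] : {dffun forall i : I, U i}.

Lemma dsum_ofE g i : dsum_of g i = g i.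
Proof. exact: ffunE. Qed.

Lemma dsumP (x y : dsum) : (forall i, x i = y i) <-> x = y.
Proof. exact: ffunP. Qed.

Definition dsum_zero : dsum := dsum_of (fun i => 0).
Definition dsum_opp (x : dsum) : dsum := dsum_of (fun i => - x i).
Definition dsum_add (x y : dsum) : dsum := dsum_of (fun i => x i + y i).
Definition dsum_scale (a : K) (x : dsum) : dsum := dsum_of (fun i => a *: x i).

Fact dsum_addA : associative dsum_add.
Proof. by move=> x y z; apply/dsumP=> i; rewrite !dsum_ofE addrA. Qed.
Fact dsum_addC : commutative dsum_add.
Proof. by move=> x y; apply/dsumP=> i; rewrite !dsum_ofE addrC. Qed.
Fact dsum_add0 : left_id dsum_zero dsum_add.
Proof. by move=> x; apply/dsumP=> i; rewrite !dsum_ofE add0r. Qed.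
Fact dsum_addN : left_inverse dsum_zero dsum_opp dsum_add.
Proof. by move=> x; apply/dsumP=> i; rewrite !dsum_ofE addNr. Qed.

HB.instance Definition _ :=
  GRing.isZmodule.Build dsum dsum_addA dsum_addC dsum_add0 dsum_addN.

Fact dsum_scaleA a b x : dsum_scale a (dsum_scale b x) = dsum_scale (a * b) x.
Proof. by apply/dsumP=> i; rewrite !dsum_ofE scalerA. Qed.
Fact dsum_scale1 : left_id 1 dsum_scale.
Proof. by move=> x; apply/dsumP=> i; rewrite !dsum_ofE scale1r. Qed.
Fact dsum_scaleDr : right_distributive dsum_scale +%R.
Proof. by move=> a x y; apply/dsumP=> i; rewrite !dsum_ofE scalerDr. Qed.
Fact dsum_scaleDl x : {morph dsum_scale^~ x : a b / a + b}.
Proof. by move=> a b; apply/dsumP=> i; rewrite !dsum_ofE scalerDl. Qed.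

HB.instance Definition _ := GRing.Zmodule_isLmodule.Build K dsum
  dsum_scaleA dsum_scale1 dsum_scaleDr dsum_scaleDl.

Lemma dsumD (x y : dsum) i : (x + y) i = x i + y i.
Proof. exact: dsum_ofE. Qed.
Lemma dsumZ a (x : dsum) i : (a *: x) i = a *: x i.
Proof. exact: dsum_ofE. Qed.
Lemma dsum0 i : (0 : dsum) i = 0.
Proof. exact: dsum_ofE. Qed.

Import VectorInternalTheory.

Fact dsum_vect_iso :
  Vector.axiom (\sum_(j < #|I|) dim (U (enum_val j)))%N dsum.
Proof.
exists (fun x : dsum => \mxrow_(j < #|I|) v2r (x (enum_val j))).
  move=> a x y; apply/mxrowP=> j.
  rewrite submxrowD !mxrowK dsumD dsumZ linearP; congr (_ + _) => /=.
  rewrite -[v2r _ in LHS](mxrowK (fun l => v2r (x (enum_val l))) j).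
  by apply/rowP=> k; rewrite !mxE.
pose d (j : 'I_#|I|) := dim (U (enum_val j)).
pose g (r : 'rV_(\sum_j d j)%N) i : U i :=
  ecast i (U i : Type) (enum_rankK i) (@r2v _ (U (enum_val (enum_rank i))) (submxrow r (enum_rank i))).
exists (fun r => dsum_of (g r)) => [x|r].
  apply/dsumP=> i; rewrite dsum_ofE /g mxrowK v2rK.
  by move: (enum_rankK i); move: (enum_val _) => k e; case: i / e.
apply/mxrowP=> j; rewrite mxrowK dsum_ofE /g.
suff key (k : 'I_#|I|) (e : enum_val k = enum_val j) :
  v2r (ecast i (U i : Type) e (@r2v _ (U (enum_val k)) (submxrow r k))) = submxrow r j by exact: key.
have kj : k = j by exact: enum_val_inj.
by case: j / kj e => e; rewrite (eq_axiomK e) /= r2vK.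
Qed.

HB.instance Definition _ := Lmodule_hasFinDim.Build K dsum dsum_vect_iso.

Definition dsum_in (i : I) (u : U i) : dsum :=
  dsum_of (dfwith (fun j => 0 : U j) u).

Lemma dsum_in_neq i (u : U i) j : i != j -> dsum_in u j = 0.
Proof. by move=> ij; rewrite dsum_ofE dfwith_out. Qed.

Lemma dsum_in_is_linear i : linear (@dsum_in i).
Proof.
move=> a u v; apply/dsumP=> j; rewrite dsumD dsumZ !dsum_ofE.
have [<-|ij] := eqVneq i j; first by rewrite !dfwith_in.
by rewrite !dfwith_out // scaler0 addr0.
Qed.

HB.instance Definition _ i :=
  GRing.isLinear.Build K (U i) dsum *:%R (@dsum_in i) (@dsum_in_is_linear i).

End DirectSum.

Variant label := LF | LV.

(* The alphabet {F, V^#}. *)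
Variant letter := WF | WVs.

Definition bool_of_label l := if l is LF then true else false.
Definition label_of_bool b := if b then LF else LV.
Lemma bool_of_labelK : cancel bool_of_label label_of_bool.
Proof. by case. Qed.
HB.instance Definition _ := Finite.copy label (can_type bool_of_labelK).

Definition bool_of_letter a := if a is WF then true else false.
Definition letter_of_bool b := if b then WF else WVs.
Lemma bool_of_letterK : cancel bool_of_letter letter_of_bool.
Proof. by case. Qed.
HB.instance Definition _ := Finite.copy letter (can_type bool_of_letterK).

Section LabeledGraphs.

Context {L : finType}.

Record lgraph := LGraph {
  vertex : finType;
  arrows : {set vertex * vertex * L}
}.

Definition tail_of {T : Type} (e : T * T * L) : T := e.1.1.
Definition head_of {T : Type} (e : T * T * L) : T := e.1.2.
Definition label_of {T : Type} (e : T * T * L) : L := e.2.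

Definition arrow (G : lgraph) : finType := {e | e \in arrows G}.

Definition adjacent (G : lgraph) : rel (vertex G) := fun x y =>
  [exists l, ((x, y, l) \in arrows G) || ((y, x, l) \in arrows G)].

Definition connected_graph (G : lgraph) : Prop :=
  forall x y : vertex G, connect (@adjacent G) x y.

Record graph_iso (G G' : lgraph) := GraphIso {
  iso_vertex :> vertex G -> vertex G';
  iso_vertex_bij : bijective iso_vertex;
  iso_arrows : forall x y l,
    ((iso_vertex x, iso_vertex y, l) \in arrows G') = ((x, y, l) \in arrows G)
}.

Definition isomorphic_graphs (G G' : lgraph) : Prop :=
  inhabited (graph_iso G G').

Fact iso_arrow_subproof (G G' : lgraph) (f : graph_iso G G') (e : arrow G) :
  (f (tail_of (val e)), f (head_of (val e)), label_of (val e)) \in arrows G'.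
Proof. by rewrite iso_arrows; case: e => -[[x y] l]. Qed.

Definition iso_arrow (G G' : lgraph) (f : graph_iso G G') (e : arrow G) :
    arrow G' :=
  exist _ (f (tail_of (val e)), f (head_of (val e)), label_of (val e))
    (iso_arrow_subproof f e).

End LabeledGraphs.

Arguments lgraph L : clear implicits.

Definition is_kraft (G : lgraph label) : Prop :=
  [/\ forall v : vertex G,
        (#|[set e in arrows G | (tail_of e == v) || (head_of e == v)]| <= 2)%N,
      {in arrows G &, forall e1 e2, e1 <> e2 -> label_of e1 = label_of e2 ->
        head_of e1 <> head_of e2 /\ tail_of e1 <> tail_of e2}
    & {in arrows G &, forall e1 e2, label_of e1 = LF -> label_of e2 = LV ->
        head_of e1 <> tail_of e2 /\ tail_of e1 <> head_of e2}].

Record kraft_quiver := KraftQuiver {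
  kraft_graph :> lgraph label;
  kraftP : is_kraft kraft_graph
}.

Definition converse_arrow (T : Type) (e : T * T * label) : T * T * letter :=
  match e with
  | (x, y, LF) => (x, y, WF)
  | (x, y, LV) => (y, x, WVs)
  end.

Definition converse (G : lgraph label) : lgraph letter :=
  @LGraph letter (vertex G) [set converse_arrow e | e in arrows G].

(* The arrow E_i is (v i, v (i + 1), l i); ordS is the cyclic successor on    *)
(* 'I_n.                                                                      *)
Definition linear_enum (G : lgraph label)
    (v : 'I_#|vertex G| -> vertex G) (l : 'I_#|vertex G| -> letter) : Prop :=
  bijective v /\
  arrows (converse G) =
    [set (v i, v (ordS i), l i) | i : 'I_#|vertex G| & (i.+1 < #|vertex G|)%N].

Definition circular_enum (G : lgraph label)
    (v : 'I_#|vertex G| -> vertex G) (l : 'I_#|vertex G| -> letter) : Prop :=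
  bijective v /\
  arrows (converse G) = [set (v i, v (ordS i), l i) | i : 'I_#|vertex G|].

Definition linear_graph (G : lgraph label) : Prop :=
  (0 < #|vertex G|)%N /\ exists v l, @linear_enum G v l.

Definition circular_graph (G : lgraph label) : Prop :=
  (0 < #|vertex G|)%N /\ exists v l, @circular_enum G v l.

Definition has_repetitions (G : lgraph label) : Prop :=
  exists v l, @circular_enum G v l /\
    exists m, [/\ (1 <= m < #|vertex G|)%N, (m %| #|vertex G|)%N
                & forall i, l i = l (iter m (@ordS #|vertex G|) i)].

Section Twisted.

Context {K : fieldType} (sigma tau : {rmorphism K -> K}).

(* A module over the algebra presented by F, V, FV = VF = 0,                  *)
(* F a = sigma(a) F, V a = tau(a) V is a K-space with two operators           *)
(* satisfying these relations; [s \; *:%R] is the s-twisted scaling law.      *)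
Record twisted_module := TwistedModule {
  tm_space :> vectType K;
  opF : {linear tm_space -> tm_space | sigma \; *:%R};
  opV : {linear tm_space -> tm_space | tau \; *:%R};
  opFV0 : forall x, opF (opV x) = 0;
  opVF0 : forall x, opV (opF x) = 0
}.

Arguments opF {t}.
Arguments opV {t}.

Definition submodule (M : twisted_module) (N : {vspace M}) : Prop :=
  forall x, x \in N -> opF x \in N /\ opV x \in N.

Definition indecomposable_module (M : twisted_module) : Prop :=
  (fullv : {vspace M}) != 0%VS /\
  ~ exists N1 N2 : {vspace M},
      [/\ submodule N1, submodule N2, N1 != fullv, N2 != fullv
        & (N1 + N2)%VS = fullv /\ (N1 :&: N2)%VS = 0%VS].

Definition isomorphic_modules (M N : twisted_module) : Prop :=
  exists phi : {linear M -> N},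
    [/\ bijective phi, forall x, phi (opF x) = opF (phi x)
      & forall x, phi (opV x) = opV (phi x)].

Definition twist (l : label) : {rmorphism K -> K} :=
  match l with LF => sigma | LV => tau end.

Section Representations.

Context (G : lgraph label).

Record representation := Representation {
  rep_space :> vertex G -> vectType K;
  rep_map : forall e : arrow G,
    {linear rep_space (tail_of (val e)) -> rep_space (head_of (val e))
      | twist (label_of (val e)) \; *:%R}
}.

Definition strict_rep (U : representation) : Prop :=
  forall e : arrow G, bijective (rep_map U e).

Definition rep_iso (U U' : representation) : Prop :=
  exists phi : forall v, {linear U v -> U' v},
    (forall v, bijective (phi v)) /\
    forall (e : arrow G) (u : U (tail_of (val e))),
      phi _ (rep_map U e u) = rep_map U' e (phi _ u).

Definition nonzero_rep (U : representation) : Prop :=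
  exists v, exists u : U v, u != 0.

Section RepSum.

Context (U U' : representation).

Definition rep_sum_fun (e : arrow G)
    (u : U (tail_of (val e)) * U' (tail_of (val e))) :
    U (head_of (val e)) * U' (head_of (val e)) :=
  (rep_map U e u.1, rep_map U' e u.2).

Fact rep_sum_fun_linear e :
  linear_for (twist (label_of (val e)) \; *:%R) (@rep_sum_fun e).
Proof. by move=> a u v; rewrite /rep_sum_fun /= !linearP. Qed.

HB.instance Definition _ e :=
  GRing.isLinear.Build K _ _ _ (@rep_sum_fun e) (@rep_sum_fun_linear e).

Definition rep_sum : representation :=
  @Representation (fun v => (U v * U' v)%type) (fun e => @rep_sum_fun e).

End RepSum.

Definition indecomposable_rep (U : representation) : Prop :=
  nonzero_rep U /\
  ~ exists U1 U2, [/\ nonzero_rep U1, nonzero_rep U2 & rep_iso U (rep_sum U1 U2)].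

Definition twist_fun (l : label) : K^o -> K^o := twist l.

Fact twist_fun_linear l : linear_for (twist l \; *:%R) (twist_fun l).
Proof. by move=> a u v; rewrite /twist_fun rmorphD rmorphM. Qed.

HB.instance Definition _ l :=
  GRing.isLinear.Build K _ _ _ (twist_fun l) (@twist_fun_linear l).

Definition trivial_rep : representation :=
  @Representation (fun v => K^o) (fun e => twist_fun (label_of (val e))).

End Representations.

Definition pullback_rep (G G' : lgraph label) (f : graph_iso G G')
    (U' : representation G') : representation G :=
  @Representation G (fun v => U' (f v)) (fun e => rep_map U' (iso_arrow f e)).

Definition isomorphic_reps (G G' : lgraph label)
    (U : representation G) (U' : representation G') : Prop :=
  exists f : graph_iso G G', rep_iso U (pullback_rep f U').

Section KraftModule.

Context (G : kraft_quiver) (U : representation G).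

Definition graph_op (l : label) (x : dsum U) : dsum U :=
  \sum_(e : arrow G | label_of (val e) == l)
     dsum_in (rep_map U e (x (tail_of (val e)))).

Fact graph_op_linear l : linear_for (twist l \; *:%R) (graph_op l).
Proof.
move=> a x y; rewrite /graph_op /= scaler_sumr -big_split /=.
by apply: eq_bigr => e /eqP <-; rewrite dsumD dsumZ linearP /= linearP.
Qed.

HB.instance Definition _ l :=
  GRing.isLinear.Build K _ _ _ (graph_op l) (@graph_op_linear l).

Lemma graph_op_comp0 l l' x :
    {in arrows G &, forall e e', label_of e = l -> label_of e' = l' ->
       head_of e' <> tail_of e} ->
  graph_op l (graph_op l' x) = 0.
Proof.
move=> H; rewrite /graph_op big1 // => e /eqP el.
suff -> : (graph_op l' x) (tail_of (val e)) = 0 by rewrite !linear0.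
rewrite /graph_op; elim/big_ind: _ => [|y z yE zE|e' /eqP e'l].
- exact: dsum0.
- by rewrite dsumD yE zE addr0.
by apply/dsum_in_neq/eqP/H => //; exact: valP.
Qed.

Fact graph_opFV0 x : graph_op LF (graph_op LV x) = 0.
Proof.
apply: graph_op_comp0 => e e' eG e'G eF e'V.
by have [_ _ /(_ e e' eG e'G eF e'V)[_ /nesym]] := kraftP G.
Qed.

Fact graph_opVF0 x : graph_op LV (graph_op LF x) = 0.
Proof.
apply: graph_op_comp0 => e e' eG e'G eV e'F.
by have [_ _ /(_ e' e e'G eG e'F eV)[]] := kraftP G.
Qed.

Definition kraft_module : twisted_module :=
  @TwistedModule (dsum U)
    (graph_op LF : {linear dsum U -> dsum U | twist LF \; *:%R})
    (graph_op LV : {linear dsum U -> dsum U | twist LV \; *:%R})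
    graph_opFV0 graph_opVF0.

End KraftModule.

Section Kinds.

Context (M : twisted_module).

Definition relation := M -> M -> Prop.

Definition rel_comp (B2 B1 : relation) : relation :=
  fun x z => exists y, B1 x y /\ B2 y z.
Definition rel_dom (B : relation) : M -> Prop := fun x => exists y, B x y.
Definition rel_ker (B : relation) : M -> Prop := fun x => B x 0.

(* The word w_m ... w_1 is the sequence [:: w_m; ...; w_1]. *)
Definition word := seq letter.

Definition D_letter (a : letter) : relation :=
  match a with
  | WF => fun x y => y = opF x
  | WVs => fun x y => x = opV y
  end.

Fixpoint D (w : word) : relation :=
  if w is a :: w' then rel_comp (D_letter a) (D w') else fun x y => x = y.

Definition is_subset (N : {vspace M}) (P : M -> Prop) : Prop :=
  forall x, x \in N <-> P x.

(* beta = [:: beta_0; ...; beta_s] is the strictly increasing enumeration of  *)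
(* all the Ker (D w) and Dom (D w).                                           *)
Definition stabilized_sequence (beta : seq {vspace M}) : Prop :=
  [/\ head fullv beta = 0%VS, last 0%VS beta = fullv,
      sorted (fun N N' => (N <= N')%VS && (N != N')) beta,
      forall w, (exists2 N, N \in beta & is_subset N (rel_ker (D w))) /\
                (exists2 N, N \in beta & is_subset N (rel_dom (D w)))
    & forall N, N \in beta ->
        exists w, is_subset N (rel_ker (D w)) \/ is_subset N (rel_dom (D w))].

Definition elementary_interval (N N' : {vspace M}) : Prop :=
  exists beta, stabilized_sequence beta /\
    exists i, [/\ (i.+1 < size beta)%N, N = nth 0%VS beta i
                & N' = nth 0%VS beta i.+1].

Definition in_W1 (w : word) : Prop :=
  (forall x, rel_dom (D (WVs :: w)) x -> rel_ker (D (WF :: w)) x) /\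
  ~ (forall x, rel_ker (D (WF :: w)) x -> rel_dom (D (WVs :: w)) x).

Definition first_kind_interval (N N' : {vspace M}) : Prop :=
  exists w, [/\ in_W1 w, is_subset N (rel_dom (D (WVs :: w)))
              & is_subset N' (rel_ker (D (WF :: w)))].

Definition first_kind : Prop :=
  forall N N', elementary_interval N N' -> first_kind_interval N N'.

Definition second_kind : Prop :=
  forall N N', elementary_interval N N' -> ~ first_kind_interval N N'.

End Kinds.

End Twisted.

(* Main.v *)
(* Read words from their first letter on, let F act on subspaces by X |-> F^-1 X and V^# by  *)
(* X |-> V X, and let pre s be the composite action of a word s, so that Ker D(s) = pre s 0  *)
(* and Dom D(s) = pre s M.  The gap of s is the interval from pre s (V M) to                 *)
(* pre s (Ker F).  Gaps of distinct words are ordered like the words (lexicographically,    *)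
(* with V^# before the end of the word, and the end before F), and no Ker or Dom lies        *)
(* strictly inside a gap; hence at most dim M gaps are non-zero.                             *)
(*                                                                                          *)
(* If Ker F <> V M, let s be a longest word with a non-zero gap.  By maximality some x in    *)
(* Ker V and pre s (Ker F) is not in F M + pre s (V M).  Walking from x along s gives        *)
(* vectors e_i, walking from a functional which separates x from F M + pre s (V M) gives     *)
(* functionals g_i, and the matrix g_i(e_j) is triangular for the order of the words.  So    *)
(* the e_i span a direct summand, which is M; as M has as many non-zero gaps as dimensions,  *)
(* it is of the first kind and determines s.                                                 *)
(*                                                                                          *)
(* If Ker F = V M, all gaps vanish and Ker V = F M.  Every step of the canonical flag is     *)
(* then the action of one letter on a unique other step, and counting the steps shows that   *)
(* this shift is a permutation which induces isomorphisms of the quotients.  Walking to the  *)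
(* right with a section of V adapted to the flag, a large multiple of the period of the      *)
(* shift kills the lower end of each step and its image is a complement which the walk       *)
(* preserves (Fitting).  These complements decompose M along the cycles of the shift, so     *)
(* there is one cycle; distinct steps have distinct infinite words, so no repetition.        *)
(* Conversely the steps and their words recover a circular quiver without repetitions and,   *)
(* by a coordinate projection which is bijective for triangularity reasons, its strict       *)
(* representation.                                                                           *)

Require Import Defs.
From HB Require Import structures.
From mathcomp Require Import all_boot all_order all_algebra.
From mathcomp Require Import boolp zify.

Set Implicit Arguments.
Unset Strict Implicit.
Unset Printing Implicit Defensive.

Import GRing.Theory.
Local Open Scope ring_scope.

(** * Subspaces and flags *)

(** Everything depends on whether [Ker F = V M]. A word leaves a trace in [M] as a non-zero gap.
    Gaps of distinct words follow one another ([gap_ord]) and vectors picked in successive gaps are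
    independent ([free_flag]), so a gapped word costs one dimension for each of its suffixes
    ([gapped_size]).

    If [Ker F] is larger than [V M], a longest gapped word supplies a vector and a functional with
    non-zero pairing ([string_start]). The word carries them to a string of vectors ([walk]) and a
    string of functionals ([dual_walk]). The span of the former and the common kernel of the latter
    are complementary submodules, so the string is all of [M] ([string_full]). The gaps of the
    suffixes then use up the whole dimension, which leaves room neither for an elementary interval
    that is not a gap ([first_kind_gapped]) nor for another gapped word of the same length
    ([gapped_unique]).

    If [Ker F = V M], no word is gapped, and [Ker V = F M] as well. Hence no step of the canonical
    flag is lost under both letters ([act_both]), the shift of steps is a permutation ([shift_inj]),
    and a Fitting argument ([steps_period]) splits the flag into subspaces carried to one another by
    the letters ([flag_cyclic_decomposition]). Indecomposability leaves one cycle, and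
    [letters_separate] forbids repetitions. Conversely, in a circular module the quotient of [Dom]
    by [Ker] for a long word read from a vertex is the space at that vertex ([support_step]), which
    recovers the quiver and the representation ([circular_unique]).

    A non-zero module is not of both kinds, so its kind tells which case holds. *)

Section LinearAlgebra.

Context {K : fieldType} {vT : vectType K}.
Implicit Types (U X Y : {vspace vT}) (P : vT -> Prop).

Lemma strict_subv_trans :
  transitive (fun X Y : {vspace vT} => (X <= Y)%VS && (X != Y)).
Proof.
move=> Y X Z /andP[XY nXY] /andP[YZ _]; rewrite (subv_trans XY YZ).
by apply: contra_neq nXY => XZ; apply/eqP; rewrite eqEsubv XY XZ.
Qed.

Definition subspace_pred P :=
  P 0 /\ forall a x y, P x -> P y -> P (a *: x + y).

(** Adjoin to a subspace inside [P] vectors of [P] outside it; the codimension bounds the number of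
    additions. *)
Lemma vspace_of_ex P :
  subspace_pred P -> exists U : {vspace vT}, forall x, x \in U <-> P x.
Proof.
move=> [P0 PL].
suff grow k : forall U, (\dim {:vT} - \dim U <= k)%N -> (forall x, x \in U -> P x) ->
    exists U' : {vspace vT}, forall x, x \in U' <-> P x.
  apply: (grow _ 0%VS (leqnn _)) => x; rewrite memv0 => /eqP->; exact: P0.
elim: k => [|k IH] U dU UP.
  exists U => x; split=> [/UP//|_].
  have -> : U = fullv.
    by apply/eqP; rewrite eqEdim subvf -subn_eq0 -leqn0.
  exact: memvf.
have [[x Px xU]|PU] := pselect (exists2 x, P x & x \notin U); last first.
  exists U => x; split=> [/UP//|Px]; apply/negPn/negP => xU.
  by apply: PU; exists x.
apply: (IH (<[x]> + U)%VS) => [|y /memv_addP[_ /vlineP[a ->] [z zU ->]]]; last first.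
  exact: PL (UP _ zU).
have ltU : (\dim U < \dim (<[x]> + U))%N.
  rewrite ltnNge; apply/negP => le.
  have /eqP eqU : (U == <[x]> + U)%VS by rewrite eqEdim addvSr.
  by move/negP: xU; apply; rewrite eqU (subvP (addvSl _ _)) // memv_line.
rewrite leq_subLR; move: dU; rewrite leq_subLR => /leq_trans-> //.
by rewrite addnS -addSn leq_add2r.
Qed.

(** Turns images and preimages under semilinear maps into subspaces; the default 0 is never met on a
    subspace predicate. *)
Definition vspace_of P : {vspace vT} :=
  if pselect (exists U : {vspace vT}, forall x, x \in U <-> P x) is left h
  then sval (cid h) else 0%VS.

Lemma vspace_ofP P x : subspace_pred P -> x \in vspace_of P <-> P x.
Proof.
by move=> /vspace_of_ex h; rewrite /vspace_of; case: pselect => // h'; case: cid.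
Qed.

(** The functional is the coordinate along [v], the part of [x] off [X], with respect to a
    complement [Y] of the line of [v] that contains [X]. *)
Lemma separating_functional X x : x \notin X ->
  exists f : {linear vT -> K^o}, f x = 1 /\ forall y, y \in X -> f y = 0.
Proof.
move=> xX; pose v := x - projv X x.
have vX : v \notin X.
  by apply: contra xX => /(rpredD (memv_proj X x)); rewrite addrC subrK.
have fv : free [:: v].
  by rewrite seq1_free; apply: contraNneq vX => ->; exact: mem0v.
pose b := in_tuple [:: v].
pose Y := (X + (<[v]> + X)^C)%VS.
have vY : (<[v]> :&: Y = 0)%VS.
  apply/eqP; rewrite -subv0; apply/subvP => y.
  rewrite memv_cap memv0 => /andP[/vlineP[a ->]] /memv_addP[u uX [w wC]] e.
  have wD : w \in (<[v]> + X)%VS.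
    have -> : w = a *: v - u by rewrite e addrAC subrr add0r.
    by apply: memv_add; [apply/vlineP; exists a|rewrite rpredN].
  have w0 : w = 0.
    apply/eqP; rewrite -memv0 -(capv_compl (<[v]> + X)%VS).
    by rewrite memv_cap wD wC.
  move: e; rewrite w0 addr0 => e.
  have [->|a0] := eqVneq a 0; first by rewrite scale0r.
  have : v \in X by rewrite -[v]scale1r -(mulVf a0) -scalerA e rpredZ.
  by rewrite (negPf vX).
pose g y := coord b ord0 (daddv_pi <[v]>%VS Y y).
have gL : linear (g : vT -> K^o).
  by move=> a y z; rewrite /g linearP linearP.
pose fM := GRing.isLinear.Build K vT K^o _ (g : vT -> K^o) gL.
pose f : {linear vT -> K^o} := HB.pack (g : vT -> K^o) fM.
have f0 y : y \in Y -> f y = 0.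
  move=> yY; rewrite /f /= /g.
  suff -> : daddv_pi <[v]>%VS Y y = 0 by rewrite linear0.
  have d0 : (Y :&: <[v]> = 0)%VS by rewrite capvC.
  have := daddv_pi_id d0 yY.
  have := daddv_pi_add vY (subvP (addvSr <[v]>%VS Y) _ yY).
  by move=> e1 e2; move: e1; rewrite e2 => /eqP; rewrite -subr_eq0 addrK => /eqP.
have fv1 : f v = 1.
  rewrite /f /= /g daddv_pi_id ?memv_line //.
  have -> : v = b`_(ord0 : 'I_1) by [].
  by rewrite coord_free ?eqxx.
exists f; split => [|y yX]; last by apply: f0; rewrite (subvP (addvSl _ _)).
have -> : x = v + projv X x by rewrite subrK.
rewrite linearD fv1 f0 ?addr0 //.
by rewrite (subvP (addvSl _ _)) // memv_proj.
Qed.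

(** Triangularity: in a relation, take the index [j] with [A j] of largest dimension. All other
    vectors involved lie in [A j] and [e j] does not, so its coefficient vanishes; induct on the
    support. *)
Lemma free_flag (I : finType) (A B : I -> {vspace vT}) (e : I -> vT) :
  (forall i, (A i <= B i)%VS) ->
  (forall i, e i \in B i) -> (forall i, e i \notin A i) ->
  (forall i j, i != j -> (B i <= A j)%VS \/ (B j <= A i)%VS) ->
  forall c : I -> K, \sum_i c i *: e i = 0 -> forall i, c i = 0.
Proof.
move=> leAB eB eA AB c c0.
suff H m : forall P : {set I}, (#|P| <= m)%N -> \sum_(i in P) c i *: e i = 0 ->
    {in P, forall i, c i = 0}.
  move=> i; apply: (H _ setT (leqnn _)) => //.
  by rewrite -[RHS]c0; apply: eq_bigl => j; rewrite inE.
elim: m => [|m IH] P cP P0 i iP.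
  by move: cP; rewrite leqn0 cards_eq0 => /eqP P00; rewrite P00 inE in iP.
pose j := [arg max_(j > i in P) \dim (A j)].
have [jP jmax] : j \in P /\ forall k, k \in P -> (\dim (A k) <= \dim (A j))%N.
  by rewrite /j; case: arg_maxnP.
have below k : k \in P -> k != j -> e k \in A j.
  move=> kP kj; have [/subvP-> //|BA] := AB _ _ kj.
  have /eqP eqA : (A j == A k)%VS by rewrite eqEdim (subv_trans (leAB j) BA) jmax.
  by have := subvP BA _ (eB j); rewrite -eqA (negPf (eA j)).
have cj0 : c j = 0.
  apply: contraTeq (eA j) => cj; rewrite negbK.
  move: P0; rewrite (bigD1 j) //= => /eqP; rewrite addr_eq0 => /eqP e0.
  rewrite -[e j]scale1r -(mulVf cj) -scalerA e0 rpredZ // rpredN rpred_sum //.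
  by move=> k /andP[kP kj]; rewrite rpredZ // below.
have [-> //|ij] := eqVneq i j.
apply: (IH (P :\ j)); last by rewrite !inE ij.
  by move: cP; rewrite (cardsD1 j) jP.
move: P0; rewrite (bigD1 j) //= cj0 scale0r add0r => P0; rewrite -[RHS]P0.
by apply: eq_bigl => k; rewrite !inE andbC.
Qed.

Lemma free_family (I : finType) (e : I -> vT) :
  (forall c : I -> K, \sum_i c i *: e i = 0 -> forall i, c i = 0) ->
  \dim <<codom e>> = #|I|.
Proof.
move=> H; pose t := [tuple e (enum_val i) | i < #|I|].
have ft : free t.
  apply/freeP => c c0 i.
  rewrite -[i]enum_valK -[LHS]/((fun j => c (enum_rank j)) (enum_val i)).
  apply: (H (fun j => c (enum_rank j))).
  rewrite -[RHS]c0 (reindex (@enum_val I I)) /=; last first.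
    by apply: onW_bij; exact: enum_val_bij.
  apply: eq_bigr => k _; rewrite enum_valK.
  by rewrite (nth_map k) ?size_enum_ord // nth_ord_enum.
have -> : <<codom e>>%VS = <<t>>%VS.
  apply: eq_span => x; apply/codomP/mapP => [[i ->]|[i _ ->]]; last by exists (enum_val i).
  by exists (enum_rank i); rewrite ?mem_enum // enum_rankK.
by move/eqP: ft; rewrite size_tuple.
Qed.

Lemma span_codom (I : finType) (e : I -> vT) x :
  x \in <<codom e>>%VS -> exists c : I -> K, x = \sum_i c i *: e i.
Proof.
have Psub : subspace_pred (fun x => exists c : I -> K, x = \sum_i c i *: e i).
  split; first by exists (fun=> 0); rewrite big1 // => i _; rewrite scale0r.
  move=> a _ _ [c ->] [d ->]; exists (fun i => a * c i + d i).
  by rewrite scaler_sumr -big_split; apply: eq_bigr => i _; rewrite scalerDl scalerA.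
move=> xt; apply/(vspace_ofP _ Psub); move: x xt.
apply/subvP/span_subvP => _ /codomP[i ->].
apply/(vspace_ofP _ Psub); exists (fun j => (j == i)%:R).
rewrite (bigD1 i) //= eqxx scale1r big1 ?addr0 // => j /negPf->.
by rewrite scale0r.
Qed.

Lemma flag_card (I : finType) (A B : I -> {vspace vT}) :
  (forall i, (A i <= B i)%VS) -> (forall i, ~~ (B i <= A i)%VS) ->
  (forall i j, i != j -> (B i <= A j)%VS \/ (B j <= A i)%VS) ->
  (#|I| <= \dim {:vT})%N.
Proof.
move=> leAB nBA AB.
have g i : exists2 x, x \in B i & x \notin A i by apply/subvPn.
pose e i := s2val (cid2 (g i)).
have eB i : e i \in B i by rewrite /e; case: cid2.
have eA i : e i \notin A i by rewrite /e; case: cid2.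
by rewrite -(free_family (free_flag leAB eB eA AB)) dimvS ?subvf.
Qed.

End LinearAlgebra.

(** * Words and the canonical chain *)

Arguments opF {K sigma tau t}.
Arguments opV {K sigma tau t}.

Definition op K sigma tau (M : @twisted_module K sigma tau) (l : label) :
    {linear M -> M | twist sigma tau l \; *:%R} :=
  match l with LF => opF | LV => opV end.
Arguments op {K sigma tau M}.

Section Walks.

Context {K : fieldType} {sigma tau : {rmorphism K -> K}}.
Context (sigma_bij : bijective sigma) (tau_bij : bijective tau).

Section OneModule.

Context {M : twisted_module sigma tau}.
Implicit Types (X Y : {vspace M}) (a : letter) (s : seq letter) (x y : M).

Lemma opFZ c x : opF (c *: x) = sigma c *: opF x.
Proof. exact: linearZ_LR. Qed.

Lemma opVZ c x : opV (c *: x) = tau c *: opV x.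
Proof. exact: linearZ_LR. Qed.

Definition act a X : {vspace M} :=
  match a with
  | WF => vspace_of (fun x => opF x \in X)
  | WVs => vspace_of (fun x => exists2 y, y \in X & x = opV y)
  end.

Arguments act : simpl never.

Lemma mem_actF x X : x \in act WF X <-> opF x \in X.
Proof.
apply: vspace_ofP; split; first by rewrite linear0 mem0v.
by move=> a y z yX zX; rewrite linearD opFZ memvD // memvZ.
Qed.

Lemma mem_actV x X : x \in act WVs X <-> exists2 y, y \in X & x = opV y.
Proof.
apply: vspace_ofP; split; first by exists 0; rewrite ?linear0 ?mem0v.
(* Surjectivity of [tau] is what makes [V X] stable under scalars. *)
have [ti tiK tKi] := tau_bij.
move=> a _ _ [y yX ->] [z zX ->]; exists (ti a *: y + z).
  by rewrite memvD // memvZ.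
by rewrite linearD opVZ tKi.
Qed.

Lemma mem_act a x X : x \in act a X <-> exists2 y, y \in X & D_letter a x y.
Proof.
case: a; last exact: mem_actV.
by rewrite mem_actF; split=> [xX|[y yX <-]] //; exists (opF x).
Qed.

Lemma act_mono a X Y : (X <= Y)%VS -> (act a X <= act a Y)%VS.
Proof.
move=> /subvP XY; apply/subvP => x /mem_act[y /XY yY xy].
by apply/mem_act; exists y.
Qed.

Definition kerF := act WF 0%VS.
Definition imV := act WVs fullv.

Lemma mem_kerF x : x \in kerF <-> opF x = 0.
Proof. by rewrite mem_actF memv0; split=> [/eqP|->]. Qed.

Lemma mem_imV x : x \in imV <-> exists y, x = opV y.
Proof. by rewrite mem_actV; split=> [[y _ ->]|[y ->]]; exists y; rewrite ?memvf. Qed.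

Lemma imV_kerF : (imV <= kerF)%VS.
Proof. by apply/subvP => x /mem_imV[y ->]; apply/mem_kerF; rewrite opFV0. Qed.

(** [V X] lies in [V M], hence in [Ker F], hence in any preimage under [F]. This inclusion is the
    origin of the order on words. *)
Lemma actV_actF X Y : (act WVs X <= act WF Y)%VS.
Proof.
apply: (subv_trans (act_mono WVs (subvf X))).
exact: subv_trans imV_kerF (act_mono WF (sub0v Y)).
Qed.

(* Words are read here from the first letter applied to the last one, so pre  *)
(* s X is the set of the x related by D (rev s) to some element of X.         *)
Definition pre s X := foldr act X s.

Lemma pre_mono s X Y : (X <= Y)%VS -> (pre s X <= pre s Y)%VS.
Proof. by move=> XY; elim: s => //= a s; exact: act_mono. Qed.

Lemma mem_pre w x X : (exists2 z, z \in X & D w x z) <-> x \in pre (rev w) X.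
Proof.
elim: w X => [|a w IH] X; first by split=> [[z zX /= ->]|xX] //; exists x.
rewrite rev_cons /pre foldr_rcons -/(pre _ _) -IH.
split=> [[z zX [y [xy yz]]]|[y /mem_act[z zX yz] xy]].
  by exists y => //; apply/mem_act; exists z.
by exists z => //; exists y.
Qed.

Lemma mem_dom w x : rel_dom (D w) x <-> x \in pre (rev w) fullv.
Proof. by rewrite -mem_pre; split=> [[z xz]|[z _ xz]]; exists z; rewrite ?memvf. Qed.

Lemma mem_ker w x : rel_ker (D w) x <-> x \in pre (rev w) 0%VS.
Proof.
rewrite -mem_pre /rel_ker; split=> [|[z]]; first by exists 0; rewrite ?mem0v.
by rewrite memv0 => /eqP->.
Qed.

Lemma mem_domV w x : rel_dom (D (WVs :: w)) x <-> x \in pre (rev w) imV.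
Proof. by rewrite mem_dom rev_cons /pre foldr_rcons. Qed.

Lemma mem_kerFw w x : rel_ker (D (WF :: w)) x <-> x \in pre (rev w) kerF.
Proof. by rewrite mem_ker rev_cons /pre foldr_rcons. Qed.

(** Equivalent to [in_W1 (rev s)], since the inclusion of [gap_le] always holds. *)
Definition gapped s := ~~ (pre s kerF <= pre s imV)%VS.

Lemma gap_le s : (pre s imV <= pre s kerF)%VS.
Proof. exact: pre_mono imV_kerF. Qed.

(** Strip the common first letters by monotonicity. At the first difference [WVs] lies below [WF],
    and the gap of the empty word, from [V M] to [Ker F], lies between the two. *)
Lemma gap_ord s t : s != t ->
  (pre s kerF <= pre t imV)%VS \/ (pre t kerF <= pre s imV)%VS.
Proof.
elim: s t => [|a s IH] [|b t] //=.
- case: b => _; last by right; exact: act_mono (subvf _).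
  by left; exact: act_mono (sub0v _).
- case: a => _; last by left; exact: act_mono (subvf _).
  by right; exact: act_mono (sub0v _).
have [<-|ab _] := eqVneq a b.
  rewrite eqseq_cons eqxx /= => /IH[] h; [left|right]; exact: act_mono.
by case: a b ab => [] [] // _; [right|left]; exact: actV_actF.
Qed.

Definition in_chain X := exists s, X = pre s 0%VS \/ X = pre s fullv.

Lemma chain0 : in_chain 0%VS. Proof. by exists [::]; left. Qed.
Lemma chain1 : in_chain fullv. Proof. by exists [::]; right. Qed.
Lemma chain_act a X : in_chain X -> in_chain (act a X).
Proof. by case=> s [->|->]; exists (a :: s); [left|right]. Qed.

Lemma chain_act_inv X : in_chain X ->
  X = 0%VS \/ X = fullv \/ exists a Y, in_chain Y /\ X = act a Y.
Proof.
case=> [[|a s]] /= [->|->]; [by left|by right; left|right; right|right; right].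
  by exists a, (pre s 0%VS); split=> //; exists s; left.
by exists a, (pre s fullv); split=> //; exists s; right.
Qed.

Lemma chain_ind (P : {vspace M} -> Prop) :
  P 0%VS -> P fullv -> (forall a X, in_chain X -> P X -> P (act a X)) ->
  forall X, in_chain X -> P X.
Proof.
move=> P0 P1 Pact X [s Xs]; elim: s X Xs => [|a s IH] X /= Xs.
  by case: Xs => ->.
by case: Xs => ->; apply: Pact; (try by exists s; auto); apply: IH; auto.
Qed.

Lemma chain_total X Y : in_chain X -> in_chain Y -> (X <= Y)%VS \/ (Y <= X)%VS.
Proof.
move=> cX; move: X cX Y.
apply: chain_ind => [Y _|Y _|a X cX IH Y cY]; [left; exact: sub0v|right; exact: subvf|].
case: (chain_act_inv cY) => [->|[->|[b [Z [cZ ->]]]]].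
- by right; exact: sub0v.
- by left; exact: subvf.
case: a b => [] []; try by [left; exact: actV_actF|right; exact: actV_actF].
  by case: (IH _ cZ) => h; [left|right]; exact: act_mono.
by case: (IH _ cZ) => h; [left|right]; exact: act_mono.
Qed.

(** The comparison of first letters as in [gap_ord], now with a member of the chain in place of a
    gap. *)
Lemma chain_gap X s : in_chain X ->
  (X <= pre s imV)%VS \/ (pre s kerF <= X)%VS.
Proof.
move=> cX; move: X cX s.
apply: chain_ind => [s|s|a X cX IH [|b s]]; [left; exact: sub0v|right; exact: subvf| |].
  case: a; first by right; exact: act_mono (sub0v _).
  by left; exact: act_mono (subvf _).
case: a b => [] [] /=; try by [left; exact: actV_actF|right; exact: actV_actF].
  by case: (IH s) => h; [left|right]; exact: act_mono.
by case: (IH s) => h; [left|right]; exact: act_mono.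
Qed.

Lemma gapped_drop k s : gapped s -> gapped (drop k s).
Proof.
elim: s k => [|a s IH] [|k] //= g; apply: IH; apply: contra g.
exact: act_mono.
Qed.

Lemma drop_inj s : injective (fun k : 'I_(size s).+1 => drop k s).
Proof.
move=> i j /(congr1 size); rewrite !size_drop => e0; apply/val_inj => /=.
by move: e0 (ltn_ord i) (ltn_ord j); lia.
Qed.

(** The suffixes of [s], from [s] itself to the empty word, have distinct ordered non-zero gaps. *)
Lemma gapped_size s : gapped s -> (size s < \dim {:M})%N.
Proof.
move=> gs; rewrite -[X in (X <= _)%N]card_ord.
apply: (flag_card (fun i : 'I_(size s).+1 => gap_le (drop i s))).
  by move=> i; exact: gapped_drop.
by move=> i j ij; apply: gap_ord; apply: contra_neq ij => /drop_inj.
Qed.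

(** The suffixes of [s] already give [\dim {:M}] ordered non-zero gaps. A different word of the same
    length is not a suffix of [s], so its gap would be one too many. *)
Lemma gapped_unique s t : gapped s -> gapped t -> (size s).+1 = \dim {:M} ->
  size t = size s -> t = s.
Proof.
move=> gs gt ds st; apply/eqP/negPn/negP => ts.
pose u (o : option 'I_(size s).+1) := if o is Some k then drop k s else t.
have uinj : injective u.
  have nt (i : 'I_(size s).+1) : drop i s <> t.
    move=> e0; case/negP: ts; rewrite -e0; move: (congr1 size e0).
    rewrite size_drop st; case: (nat_of_ord i) (ltn_ord i) => [|k] kl; last by lia.
    by rewrite drop0.
  move=> [i|] [j|] //= e0; first by rewrite (drop_inj e0).
    by case: (nt i).
  by case: (nt j).
suff : (#|{: option 'I_(size s).+1}| <= \dim {:M})%N.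
  by rewrite card_option card_ord -ds ltnn.
apply: (flag_card (fun o => gap_le (u o))) => [[k|]|i j ij].
- exact: gapped_drop.
- exact: gt.
by apply: gap_ord; apply: contra_neq ij => /uinj.
Qed.

End OneModule.
End Walks.
Arguments gapped {K sigma tau} M s.

(** * String summands *)

Section Strings.

Context {K : fieldType} {sigma tau : {rmorphism K -> K}}.
Context (sigma_bij : bijective sigma) (tau_bij : bijective tau).
Context {M : twisted_module sigma tau}.
Implicit Types (X Y : {vspace M}) (a : letter) (s : seq letter) (x y : M).

Lemma walk s X x : x \in pre s X -> exists e : nat -> M,
  [/\ e 0%N = x, forall k, (k < size s)%N -> D_letter (nth WF s k) (e k) (e k.+1)
    & forall k, (k <= size s)%N -> e k \in pre (drop k s) X].
Proof.
elim: s x => [|a s IH] x xs.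
  by exists (fun => x); split=> // -[|].
have /(mem_act tau_bij)[y ys xy] := xs; have [e [e0 eD eX]] := IH _ ys.
exists (fun k => if k is k'.+1 then e k' else x); split=> //.
  by case=> [|k] /= => [_|/eD//]; rewrite e0.
by case=> [|k] //= /eX.
Qed.

(** The transpose of [D_letter]: if [x] and [y] are related by the letter, then a non-zero [f x]
    forces a non-zero [g y]. *)
Definition dual_letter a (f g : {linear M -> K^o}) : Prop :=
  match a with
  | WF => forall x, g (opF x) = sigma (f x)
  | WVs => forall x, f (opV x) = tau (g x)
  end.

(** For [WVs], compose [f] with [V] and untwist by the inverse of [tau]. For [WF] and [f] non-zero,
    pick [e] with [f e = 1]. Then [F e] is outside [X + F (Ker f)]: otherwise some [e - z] with
    [f z = 0] would lie in the preimage of [X], where [f] vanishes. A functional separating [F e]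
    from this sum is the wanted [g]. *)
Lemma dual_step a X (f : {linear M -> K^o}) :
    (forall x, x \in act a X -> f x = 0) ->
  exists2 g : {linear M -> K^o}, forall x, x \in X -> g x = 0 & dual_letter a f g.
Proof.
case: a => f0 /=; last first.
  have [ti tiK tKi] := tau_bij.
  pose g x : K^o := ti (f (opV x)).
  have gL : linear g.
    move=> c x y; rewrite /g linearD opVZ linearP; apply: (can_inj tiK).
    by rewrite tKi rmorphD rmorphM !tKi.
  pose gM := GRing.isLinear.Build K M K^o _ g gL.
  exists (HB.pack g gM : {linear M -> K^o}) => x /=; last by rewrite /g tKi.
  move=> xX; rewrite /g f0 ?(can2_eq tKi tiK) //; last by apply/(mem_actV tau_bij); exists x.
  by apply: (can_inj tiK); rewrite tKi rmorph0.
have [fN|/existsNP[e1 /eqP fe1]] := pselect (forall x, f x = 0).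
  have [g gX g0] : exists2 g : {linear M -> K^o}, (forall x, x \in X -> g x = 0)
      & forall x, g x = 0.
    by exists (\0 : {linear M -> K^o}).
  by exists g => // x; rewrite g0 fN rmorph0.
pose e := (f e1)^-1 *: e1.
have fe : f e = 1 by rewrite linearZ /= [_ *: _]mulVf.
pose Z := vspace_of (fun x => exists2 z, f z = 0 & x = opF z).
have memZ x : x \in Z <-> exists2 z, f z = 0 & x = opF z.
  apply: vspace_ofP; split; first by exists 0; rewrite !linear0.
  have [si siK sKi] := sigma_bij.
  move=> c _ _ [y y0 ->] [z z0 ->]; exists (si c *: y + z).
    by rewrite linearP y0 z0 /= addr0; exact: mulr0.
  by rewrite linearD opFZ sKi.
have nFe : opF e \notin (X + Z)%VS.
  apply/negP => /memv_addP[u uX [_ /memZ[z z0 ->] Fe]].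
  have : f (e - z) = 0.
    by apply: f0; apply/mem_actF; rewrite linearB Fe addrK.
  by rewrite linearB fe z0 subr0 => /eqP; rewrite oner_eq0.
have [g [g1 g0]] := separating_functional nFe.
exists g => [x xX|x]; first by apply: g0; rewrite (subvP (addvSl _ _)).
have -> : x = f x *: e + (x - f x *: e) by rewrite addrC subrK.
rewrite linearD opFZ linearD linearZ g1 /= [X in X + _]mulr1.
rewrite [X in _ + X]g0; last first.
  apply: (subvP (addvSr _ _)); apply/memZ; exists (x - f x *: e) => //.
  by rewrite linearB linearZ fe /= [_ *: _]mulr1 subrr.
by rewrite addr0 addrC subrK.
Qed.

Lemma dual_walk s X (f : {linear M -> K^o}) :
    (forall x, x \in pre s X -> f x = 0) ->
  exists g : nat -> {linear M -> K^o},
  [/\ g 0%N = f, forall k, (k < size s)%N -> dual_letter (nth WF s k) (g k) (g k.+1)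
    & forall k, (k <= size s)%N -> forall x, x \in pre (drop k s) X -> g k x = 0].
Proof.
elim: s f => [|a s IH] f f0.
  by exists (fun => f); split=> // -[|].
have [f' f'0 ff'] := dual_step f0; have [g [g0 gD gX]] := IH _ f'0.
exists (fun k => if k is k'.+1 then g k' else f); split=> //.
  by case=> [|k] /= => [_|/gD//]; rewrite g0.
by case=> [|k] //= /gX.
Qed.

Lemma dual_letter_neq0 a (f g : {linear M -> K^o}) x y :
  dual_letter a f g -> D_letter a x y -> f x != 0 -> g y != 0.
Proof.
case: a => /= fg ->; first by rewrite fg fmorph_eq0.
by rewrite fg fmorph_eq0.
Qed.

Lemma span_submodule (t : seq M) :
  (forall x, x \in t -> opF x \in <<t>>%VS /\ opV x \in <<t>>%VS) ->
  submodule <<t>>%VS.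
Proof.
move=> H x /(@coord_span _ _ _ (in_tuple t))->.
by split; rewrite linear_sum rpred_sum // => i _;
  rewrite ?opFZ ?opVZ rpredZ //; case: (H (in_tuple t)`_i); rewrite ?mem_nth.
Qed.

Section MainString.

Context (M_indec : indecomposable_module M).
Context (s : seq letter) (e : nat -> M) (g : nat -> {linear M -> K^o}).
Hypothesis eD : forall k, (k < size s)%N -> D_letter (nth WF s k) (e k) (e k.+1).
Hypothesis eB : forall k, (k <= size s)%N -> e k \in pre (drop k s) kerF.
Hypothesis gD : forall k, (k < size s)%N -> dual_letter (nth WF s k) (g k) (g k.+1).
Hypothesis gA : forall k, (k <= size s)%N ->
  forall x, x \in pre (drop k s) imV -> g k x = 0.
Hypothesis e0 : opV (e 0%N) = 0.
Hypothesis g0 : forall x, g 0%N (opF x) = 0.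
Hypothesis ge0 : g 0%N (e 0%N) != 0.

Let n := (size s).+1.
Let eI (k : 'I_n) := e k.

Lemma string_opF k : (k <= size s)%N ->
  opF (e k) = if (k < size s)%N && (nth WF s k == WF) then e k.+1 else 0.
Proof.
rewrite leq_eqVlt => /predU1P[->|ks].
  by rewrite ltnn; have := eB (leqnn _); rewrite drop_size => /mem_kerF->.
rewrite ks /=; have := eD ks; case: (nth _ _ _) => /= [->|->] //.
exact: opFV0.
Qed.

Lemma string_opVS k : (k < size s)%N ->
  opV (e k.+1) = if nth WF s k == WVs then e k else 0.
Proof.
by move=> ks; have := eD ks; case: (nth _ _ _) => /= [->|->] //; exact: opVF0.
Qed.

Lemma string_pair k : (k <= size s)%N -> g k (e k) != 0.
Proof.
elim: k => [|k IH] ks; first exact: ge0.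
by apply: dual_letter_neq0 (gD ks) (eD ks) (IH (ltnW ks)).
Qed.

Let A (k : 'I_n) := pre (drop k s) (imV : {vspace M}).
Let B (k : 'I_n) := pre (drop k s) (kerF : {vspace M}).
Let leAB k : (A k <= B k)%VS. Proof. exact: gap_le. Qed.
Let eIB k : eI k \in B k. Proof. exact: eB (ltn_ord k). Qed.
Let AB i j : i != j -> (B i <= A j)%VS \/ (B j <= A i)%VS.
Proof. by move=> ij; apply: gap_ord => //; apply: contra_neq ij => /drop_inj. Qed.
Let eIA k : eI k \notin A k.
Proof.
have ks : (k <= size s)%N := ltn_ord k.
by apply: contra (string_pair ks) => h; apply/eqP/gA.
Qed.

Lemma string_free (c : 'I_n -> K) : \sum_i c i *: eI i = 0 -> forall i, c i = 0.
Proof. exact: free_flag leAB eIB eIA AB c. Qed.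

Let t := codom eI.

Lemma string_submodule : submodule <<t>>%VS.
Proof.
have et k : (k < n)%N -> e k \in <<t>>%VS.
  by move=> kn; apply/memv_span/codomP; exists (Ordinal kn).
apply: span_submodule => _ /codomP[[k kn] ->]; rewrite /eI /=; split.
  rewrite string_opF //; case: ifP => [/andP[ks _]|_]; last exact: mem0v.
  exact: et.
case: k kn => [|k] kn; first by rewrite e0 mem0v.
rewrite string_opVS //; case: ifP => _; last exact: mem0v.
by apply: et; rewrite ltnW.
Qed.

Let Phi x : 'rV[K]_n := \row_(k < n) g k x.
Let Phi_linear : linear Phi.
Proof. by move=> c x y; apply/rowP => k; rewrite !mxE linearP. Qed.
HB.instance Definition _ := GRing.isLinear.Build K M 'rV[K]_n _ Phi Phi_linear.
(** The common kernel of the functionals [g k], which will be the complement of the string. *)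
Let N := lker (linfun Phi).

Let memN x : reflect (forall k, (k <= size s)%N -> g k x = 0) (x \in N).
Proof.
rewrite memv_ker lfunE /=; apply: (iffP eqP) => [/rowP h k ks|h].
  by have := h (Ordinal (ks : (k < n)%N)); rewrite !mxE.
by apply/rowP => k; rewrite !mxE (h k (ltn_ord k)).
Qed.

(** At the two ends, [g 0] vanishes on [F M] and the last functional on [V M]; in between use
    [dual_letter], together with [F V = V F = 0] when the letter is of the other sort. *)
Let N_submodule : submodule N.
Proof.
move=> x /memN x0; split; apply/memN.
  case=> [|k] ks; first by rewrite g0.
  have := gD ks; case: (nth _ _ _) => /= gk; first by rewrite gk x0 ?rmorph0 // ltnW.
  by apply/(fmorph_inj tau); rewrite -gk opVF0 linear0 rmorph0.
move=> k; rewrite leq_eqVlt => /predU1P[->|ks].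
  by apply: gA => //; rewrite drop_size; apply/(mem_imV tau_bij); exists x.
have := gD ks; case: (nth _ _ _) => /= gk; last by rewrite gk x0 ?rmorph0.
by apply/(fmorph_inj sigma); rewrite -gk opFV0 linear0 rmorph0.
Qed.

(* The matrix of the g i (e j) is triangular for the order of the words drop j s. *)
Let tN : (<<t>> :&: N = 0)%VS.
Proof.
apply/eqP; rewrite -subv0; apply/subvP => x; rewrite memv_cap => /andP[xt /memN xN].
have [c xc] := span_codom xt.
suff : forall i, c i = 0 by move=> c0; rewrite memv0 xc big1 // => i _; rewrite c0 scale0r.
have [/existsP[i0 ci0]|nc] := boolP [exists i, c i != 0]; last first.
  by move=> i; apply/eqP; apply: contraNT nc => ci; apply/existsP; exists i.
exfalso.
pose j := [arg max_(j > i0 | c j != 0) \dim (A j)].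
have [cj jmax] : c j != 0 /\ forall k, c k != 0 -> (\dim (A k) <= \dim (A j))%N.
  by rewrite /j; case: arg_maxnP.
have js : (j <= size s)%N := ltn_ord j.
have := xN j js; rewrite xc linear_sum (bigD1 j) //= big1 ?addr0.
  by rewrite linearZ => /eqP; rewrite [_ *: _ == _]mulf_eq0 (negPf cj) (negPf (string_pair js)).
move=> k kj; have [->|ck] := eqVneq (c k) 0; first by rewrite scale0r linear0.
suff gk : g j (eI k) = 0 by rewrite linearZ /= gk; exact: mulr0.
apply: gA => //.
have [/subvP sub|BA] := AB kj; first exact: sub.
have /eqP eqA : (A j == A k)%VS by rewrite eqEdim (subv_trans (leAB j) BA) jmax.
by have := subvP BA _ (eIB j); rewrite -eqA (negPf (eIA j)).
Qed.

(** [N] is cut out by [n] functionals and the string has dimension [n]; as they meet in 0, they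
    decompose [M]. [N] is proper because [g 0] is non-zero on [e 0]. *)
Lemma string_full : <<t>>%VS = fullv.
Proof.
apply/eqP/negPn/negP => tF; case: M_indec => _; case.
exists <<t>>%VS, N; split=> //; first exact: string_submodule.
  apply: contraL ge0 => /eqP NF; rewrite negbK; apply/eqP.
  by have /memN-> : e 0%N \in N by rewrite NF memvf.
split; last exact: tN.
apply/eqP; rewrite eqEdim subvf dimv_disjoint_sum //.
rewrite (free_family string_free) card_ord -(limg_ker_dim (linfun Phi) fullv).
rewrite capfv -/N addnC leq_add2r (leq_trans (dimvS (subvf _))) //.
by rewrite dimvf /dim /= mul1n.
Qed.

Lemma string_dim : n = \dim {:M}.
Proof. by rewrite -string_full (free_family string_free) card_ord. Qed.

End MainString.

End Strings.

(** * Kraft quivers and their modules *)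

Section Quiver.

Context {T : finType} (S : T -> T) (E : {set T}) (l : T -> letter).

Definition quiver_arrow (i : T) : T * T * label :=
  match l i with WF => (i, S i, LF) | WVs => (S i, i, LV) end.

(** Built from its converse, whose arrows are [(i, S i, l i)] for [i] in [E]. Strings omit the last
    index from [E], cycles omit none. *)
Definition quiver_graph : lgraph label :=
  @LGraph label T [set quiver_arrow i | i in E].

Lemma quiver_arrowF i j :
  ((i, j, LF) \in arrows quiver_graph) = [&& i \in E, l i == WF & j == S i].
Proof.
apply/imsetP/and3P => [[k kE]|[iE /eqP li /eqP->]]; last first.
  by exists i => //; rewrite /quiver_arrow li.
rewrite /quiver_arrow; case lk: (l k) => // -[-> ->].
by rewrite kE lk !eqxx.
Qed.

Lemma quiver_arrowV i j :
  ((i, j, LV) \in arrows quiver_graph) = [&& j \in E, l j == WVs & i == S j].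
Proof.
apply/imsetP/and3P => [[k kE]|[iE /eqP li /eqP->]]; last first.
  by exists j => //; rewrite /quiver_arrow li.
rewrite /quiver_arrow; case lk: (l k) => // -[-> ->].
by rewrite kE lk !eqxx.
Qed.

Lemma quiver_converse :
  arrows (converse quiver_graph) = [set (i, S i, l i) | i in E].
Proof.
rewrite /converse /= -imset_comp; apply: eq_imset => i /=.
by rewrite /quiver_arrow; case: (l i).
Qed.

Hypothesis S_inj : injective S.

(** The arrows touching [v] are indexed by [v] and by its preimage under [S]. An F-arrow and a
    V-arrow that meet head to tail would have the same index, hence the same letter. *)
Lemma quiver_kraft : is_kraft quiver_graph.
Proof.
split.
- move=> v; pose W := [set i | (i == v) || (S i == v)].
  apply: (@leq_trans #|[set quiver_arrow i | i in W]|).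
    apply/subset_leq_card/subsetP => e; rewrite inE => /andP[/imsetP[i iE ->]].
    move=> h; apply/imsetP; exists i => //; rewrite inE.
    by move: h; rewrite /quiver_arrow; case: (l i); rewrite /tail_of /head_of //= orbC.
  apply: (leq_trans (leq_imset_card _ _)).
  have -> : W = [set v] :|: [set i | S i == v] by apply/setP => i; rewrite !inE.
  rewrite (leq_trans (leq_card_setU _ _)) // cards1 add1n ltnS.
  by apply/card_le1_eqP => i j; rewrite !inE => /eqP <- /eqP /S_inj.
- move=> _ _ /imsetP[i iE ->] /imsetP[j jE ->] ij.
  have {}ij : i <> j by move=> e; apply: ij; rewrite e.
  rewrite /quiver_arrow; case: (l i) (l j) => [] [] // _; rewrite /head_of /tail_of /=.
    by split=> // /S_inj.
  by split=> // /S_inj.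
move=> _ _ /imsetP[i iE ->] /imsetP[j jE ->].
rewrite /quiver_arrow; case li: (l i) => //; case lj: (l j) => // _ _.
rewrite /head_of /tail_of /=; split=> [/S_inj ij|ij].
  by rewrite ij lj in li.
by rewrite ij lj in li.
Qed.

Definition quiver : kraft_quiver := KraftQuiver quiver_kraft.

End Quiver.

Section DirectSumFacts.

Context {K : fieldType} {I : finType} (U : I -> vectType K).

Lemma dsum_in_eq i (u : U i) : dsum_in u i = u.
Proof. by rewrite dsum_ofE dfwith_in. Qed.

Lemma dsum_sum (J : Type) (r : seq J) (P : pred J) (F : J -> dsum U) i :
  (\sum_(j <- r | P j) F j) i = \sum_(j <- r | P j) F j i.
Proof.
exact: (big_morph (fun x : dsum U => x i) (fun x y => dsumD x y i) (dsum0 U i)).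
Qed.

Lemma dsum_inE (x : dsum U) : x = \sum_i dsum_in (x i).
Proof.
apply/dsumP => i; rewrite dsum_sum (bigD1 i) //= dsum_in_eq big1 ?addr0 // => j ji.
by rewrite dsum_in_neq.
Qed.

End DirectSumFacts.

(** * Isomorphisms and idempotent endomorphisms of modules *)

Section Morphisms.

Context {K : fieldType} {sigma tau : {rmorphism K -> K}}.
Implicit Types M N : twisted_module sigma tau.

Lemma bijective_linear_inv (V W : lmodType K) (f : {linear V -> W}) :
  bijective f -> exists g : {linear W -> V}, cancel f g /\ cancel g f.
Proof.
case=> g fK gK; have gL : linear g.
  by move=> a x y; apply: (can_inj fK); rewrite linearP !gK.
pose gM := GRing.isLinear.Build K W V _ g gL.
by exists (HB.pack g gM : {linear W -> V}).
Qed.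

Lemma isomorphic_modules_sym M N :
  isomorphic_modules M N -> isomorphic_modules N M.
Proof.
case=> f [/bijective_linear_inv[g [fK gK]] fF fV]; exists g; split.
- by exists f.
- by move=> x; apply: (can_inj fK); rewrite fF !gK.
- by move=> x; apply: (can_inj fK); rewrite fV !gK.
Qed.

Lemma isomorphic_modules_trans M N P :
  isomorphic_modules M N -> isomorphic_modules N P -> isomorphic_modules M P.
Proof.
case=> f [fb fF fV] [g [gb gF gV]]; exists (g \o f); split.
- exact: bij_comp.
- by move=> x /=; rewrite fF gF.
- by move=> x /=; rewrite fV gV.
Qed.

Lemma isomorphic_modules_dim M N :
  isomorphic_modules M N -> \dim {:M} = \dim {:N}.
Proof.
case=> f [fb _ _]; rewrite -(limg_ker_dim (linfun f) fullv).
have -> : lker (linfun f) = 0%VS.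
  apply/eqP/lker0P => x y; rewrite !lfunE /=.
  exact: bij_inj fb _ _.
rewrite capv0 dimv0 add0n; congr (\dim _); apply/eqP; rewrite eqEsubv subvf.
apply/subvP => y _; case: fb => g _ gK.
by apply/memv_imgP; exists (g y); rewrite ?memvf // lfunE /= gK.
Qed.

(** The image and the kernel of [p] are complementary submodules. *)
Lemma indecomposable_idempotent M (p : M -> M) : indecomposable_module M ->
  linear p -> (forall x, p (p x) = p x) ->
  (forall x, p (opF x) = opF (p x)) -> (forall x, p (opV x) = opV (p x)) ->
  (forall x, p x = 0) \/ (forall x, p x = x).
Proof.
move=> [_ M_indec] pL pp pF pV.
pose q := linfun (HB.pack p (GRing.isLinear.Build K M M _ p pL) : {linear M -> M}).
have qE x : q x = p x by rewrite lfunE.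
have memI x : (x \in limg q) <-> p x = x.
  split=> [/memv_imgP[y _ ->]|xp]; first by rewrite qE pp.
  by apply/memv_imgP; exists x; rewrite ?memvf // qE.
have memK x : (x \in lker q) <-> p x = 0 by rewrite memv_ker qE; split=> /eqP.
have p0 : p 0 = 0 by rewrite -qE linear0.
have pB x y : p (x - y) = p x - p y by rewrite -!qE linearB.
have [p1|n1] := pselect (forall x, p x = x); first by right.
have [p0'|n0] := pselect (forall x, p x = 0); first by left.
exfalso; apply: M_indec; exists (limg q), (lker q); split.
- by move=> x /memI xp; split; apply/memI; rewrite ?pF ?pV xp.
- by move=> x /memK xp; split; apply/memK; rewrite ?pF ?pV xp linear0.
- by apply/eqP => full; apply: n1 => x; apply/memI; rewrite full memvf.
- by apply/eqP => full; apply: n0 => x; apply/memK; rewrite full memvf.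
split; apply/eqP.
  rewrite eqEsubv subvf; apply/subvP => x _; rewrite -[x](subrK (p x)) addrC.
  by apply: memv_add; [apply/memI|apply/memK; rewrite pB pp subrr].
rewrite -subv0; apply/subvP => x; rewrite memv_cap => /andP[/memI xp /memK].
by rewrite xp => ->; exact: mem0v.
Qed.

End Morphisms.

(** * Kraft modules, and what indecomposability forces on the quiver *)

Section KraftModules.

Context {K : fieldType} {sigma tau : {rmorphism K -> K}}.
Context {G : kraft_quiver} (U : representation sigma tau G).

Lemma kraft_opE l (x : kraft_module U) : op l x = graph_op l x.
Proof. by case: l. Qed.

Lemma arrow_head (e1 e2 : arrow G) : label_of (val e1) = label_of (val e2) ->
  head_of (val e1) = head_of (val e2) -> e1 = e2.
Proof.
move=> ll hh; apply/val_inj/eqP/negPn/negP => /eqP ne.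
by have [_ /(_ _ _ (valP e1) (valP e2) ne ll)[]] := kraftP G.
Qed.

Lemma arrow_tail (e1 e2 : arrow G) : label_of (val e1) = label_of (val e2) ->
  tail_of (val e1) = tail_of (val e2) -> e1 = e2.
Proof.
move=> ll hh; apply/val_inj/eqP/negPn/negP => /eqP ne.
by have [_ /(_ _ _ (valP e1) (valP e2) ne ll)[]] := kraftP G.
Qed.

(** A Kraft quiver has at most one arrow with a given label into a given vertex, so one term of the
    sum reaches this coordinate. *)
Lemma graph_op_head (e : arrow G) (x : dsum U) :
  graph_op (label_of (val e)) x (head_of (val e)) = rep_map U e (x (tail_of (val e))).
Proof.
rewrite /graph_op dsum_sum (bigD1 e) //= dsum_in_eq big1 ?addr0 // => f /andP[/eqP lf fe].
by rewrite dsum_in_neq //; apply: contra_neq fe => hf; exact: arrow_head.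
Qed.

Lemma graph_op_head0 l (x : dsum U) v :
  (forall u, (u, v, l) \notin arrows G) -> graph_op l x v = 0.
Proof.
move=> H; rewrite /graph_op dsum_sum big1 // => -[[[a b] k] /= eG] /eqP kl.
rewrite dsum_in_neq //; apply: contraTneq eG => bv.
by move: kl bv; rewrite /label_of /head_of /= => -> ->.
Qed.

Lemma graph_op_in (e : arrow G) (u : U (tail_of (val e))) :
  graph_op (label_of (val e)) (dsum_in u) = dsum_in (rep_map U e u).
Proof.
rewrite /graph_op (bigD1 e) //= dsum_in_eq big1 ?addr0 // => f /andP[/eqP lf fe].
rewrite dsum_in_neq ?linear0 //; apply: contra_neq fe => hf.
exact/esym/arrow_tail.
Qed.

Lemma graph_op_in0 l v (u : U v) :
  (forall w, (v, w, l) \notin arrows G) -> graph_op l (dsum_in u) = 0.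
Proof.
move=> H; rewrite /graph_op big1 // => -[[[a b] k] /= eG] /eqP kl.
rewrite dsum_in_neq ?linear0 //; apply: contraTneq eG => va.
by move: kl va; rewrite /label_of /tail_of /= => -> <-.
Qed.

Lemma graph_op_sum l (x : dsum U) :
  graph_op l x = \sum_v graph_op l (dsum_in (x v)).
Proof. by rewrite [x in LHS]dsum_inE (linear_sum (@graph_op _ _ _ _ U l)). Qed.

Lemma kraft_module_iso (M : twisted_module sigma tau)
    (f : forall v, {linear U v -> M}) :
  (forall (e : arrow G) u, op (label_of (val e)) (f _ u) = f _ (rep_map U e u)) ->
  (forall l v u, (forall w, (v, w, l) \notin arrows G) -> op l (f v u) = 0) ->
  (forall x : dsum U, \sum_v f v (x v) = 0 -> x = 0) ->
  (forall y : M, exists x : dsum U, y = \sum_v f v (x v)) ->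
  isomorphic_modules M (kraft_module U).
Proof.
move=> fe f0 inj surj; apply: isomorphic_modules_sym.
pose g (x : kraft_module U) : M := \sum_v f v ((x : dsum U) v).
have gL : linear g.
  move=> a x y; rewrite /g scaler_sumr -big_split; apply: eq_bigr => v _.
  by rewrite dsumD dsumZ linearP.
pose h : {linear kraft_module U -> M} :=
  HB.pack g (GRing.isLinear.Build K (kraft_module U) M _ g gL).
have g_in v (u : U v) : h (dsum_in u) = f v u.
  rewrite /= /g (bigD1 v) //= dsum_in_eq big1 ?addr0 // => w wv.
  by rewrite dsum_in_neq ?linear0 // eq_sym.
have gop l x : h (op l x) = op l (h x).
  rewrite kraft_opE graph_op_sum linear_sum [h x]/(g x) linear_sum.
  apply: eq_bigr => v _.
  have [[w vw]|nw] := pselect (exists w, (v, w, l) \in arrows G).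
    pose e : arrow G := exist _ (v, w, l) vw.
    by rewrite (@graph_op_in e) g_in -(fe e).
  have {}nw w : (v, w, l) \notin arrows G by apply/negP => vw; apply: nw; exists w.
  by rewrite graph_op_in0 // linear0 f0.
exists h; split; last first.
- exact: gop LV.
- exact: gop LF.
have inj' : injective h.
  move=> x y xy; apply/eqP; rewrite -subr_eq0; apply/eqP/inj.
  by rewrite -[LHS]/(h (x - y)) linearB xy subrr.
exists (fun y => sval (cid (surj y)) : kraft_module U) => [x|y]; last by case: cid.
by apply: inj'; case: cid.
Qed.

(** Coordinatewise action of [p] is an idempotent endomorphism of the Kraft module; transport it to
    [M]. *)
Lemma kraft_idempotent (M : twisted_module sigma tau) (p : forall v, U v -> U v) :
  indecomposable_module M -> isomorphic_modules M (kraft_module U) ->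
  (forall v, linear (p v)) -> (forall v u, p v (p v u) = p v u) ->
  (forall (e : arrow G) u, p _ (rep_map U e u) = rep_map U e (p _ u)) ->
  (forall v u, p v u = 0) \/ (forall v u, p v u = u).
Proof.
move=> M_indec [f [/bijective_linear_inv[g [fK gK]] fF fV]] pL pp pe.
pose q (x : dsum U) : dsum U := dsum_of (fun v => p v (x v)).
have qL : linear q.
  move=> a x y; apply/dsumP => v.
  rewrite (dsumD (a *: q x)) dsumZ [LHS]dsum_ofE.
  by rewrite (dsumD (a *: x)) dsumZ pL !dsum_ofE.
have qin v (u : U v) : q (dsum_in u) v = p v u by rewrite dsum_ofE dsum_in_eq.
have p0 v : p v 0 = 0.
  by have := pL v (-1) 0 0; rewrite scaleN1r oppr0 addr0 scaleN1r addNr.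
have qop l (x : dsum U) : q (graph_op l x) = graph_op l (q x).
  apply/dsumP => v; rewrite dsum_ofE.
  have [[w vw]|nw] := pselect (exists w, (w, v, l) \in arrows G).
    pose e : arrow G := exist _ (w, v, l) vw.
    transitivity (rep_map U e (q x w)); last exact/esym/(graph_op_head e (q x)).
    by rewrite dsum_ofE -(pe e); congr (p v _); exact: (graph_op_head e x).
  have {}nw w : (w, v, l) \notin arrows G by apply/negP => vw; apply: nw; exists w.
  by rewrite !graph_op_head0.
pose r x : M := g (q (f x)).
case: (@indecomposable_idempotent _ _ _ M r M_indec).
- by move=> a x y; rewrite /r linearP qL linearP.
- move=> x; rewrite /r gK; congr (g _); apply/dsumP => v.
  by rewrite !dsum_ofE pp.
- move=> x; apply: (can_inj fK); rewrite /r fF gK fF gK.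
  exact: (qop LF).
- move=> x; apply: (can_inj fK); rewrite /r fV gK fV gK.
  exact: (qop LV).
- move=> r0; left=> v u; rewrite -qin.
  have := congr1 f (r0 (g (dsum_in u))); rewrite /r !gK linear0 => ->.
  exact: dsum0.
move=> r1; right=> v u; rewrite -qin.
by have := congr1 f (r1 (g (dsum_in u))); rewrite /r !gK => ->; rewrite dsum_in_eq.
Qed.

Lemma adjacent_sym : symmetric (@adjacent label G).
Proof. by move=> x y; apply: eq_existsb => l; rewrite orbC. Qed.

(** Apply [kraft_idempotent] to the projection onto the component of [x]. *)
Lemma indecomposable_connected (M : twisted_module sigma tau) :
  indecomposable_module M -> isomorphic_modules M (kraft_module U) ->
  (forall v, exists u : U v, u != 0) -> connected_graph G.
Proof.
move=> M_indec MU nz x y; pose O v := connect (@adjacent label G) x v.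
have csym : connect_sym (@adjacent label G) by exact: sym_connect_sym adjacent_sym.
case: (@kraft_idempotent M (fun v u => if O v then u else 0) M_indec MU).
- by move=> v a u w; case: ifP => // _; rewrite scaler0 addr0.
- by move=> v u; case: (O v).
- move=> e u; have -> : O (head_of (val e)) = O (tail_of (val e)).
    apply: (same_connect1r csym); apply/existsP.
    exists (label_of (val e)); case: e u => -[[a b] l] /= eG _.
    by rewrite /head_of /tail_of /label_of /= eG orbT.
  by case: ifP => // _; rewrite linear0.
- move=> h; have [u u0] := nz x; have := h x u.
  by rewrite /O connect0 => u00; rewrite u00 eqxx in u0.
move=> h; have [u u0] := nz y; have := h y u.
by rewrite /O; case: ifP => // _ u00; rewrite -u00 eqxx in u0.
Qed.

(** The projection onto a summand would be an idempotent other than 0 and the identity. *)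
Lemma indecomposable_kraft_rep (M : twisted_module sigma tau) :
  indecomposable_module M -> isomorphic_modules M (kraft_module U) ->
  nonzero_rep U -> indecomposable_rep U.
Proof.
move=> M_indec MU nz; split=> // -[U1 [U2 [[v1 [u1 nz1]] [v2 [u2 nz2]] [f [fb fe]]]]].
have ex v : exists g : {linear rep_sum U1 U2 v -> U v}, cancel (f v) g /\ cancel g (f v).
  exact: bijective_linear_inv (fb v).
pose g v := sval (cid (ex v)).
have fK v : cancel (f v) (g v) by rewrite /g; case: cid => ? [].
have gK v : cancel (g v) (f v) by rewrite /g; case: cid => ? [].
case: (@kraft_idempotent M (fun v u => g v ((f v u).1, 0)) M_indec MU).
- move=> v a u w; rewrite -linearP; congr (g v _).
  by rewrite linearP; apply: injective_projections; rewrite //= scaler0 addr0.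
- by move=> v u; rewrite gK.
- move=> e u; apply: (can_inj (fK _)); rewrite !(fe, gK).
  by apply: injective_projections => /=; rewrite ?linear0.
- move=> h; have := congr1 (f v1) (h v1 (g v1 (u1, 0))); rewrite !gK linear0 => -[e].
  by rewrite e eqxx in nz1.
move=> h; have := congr1 (f v2) (h v2 (g v2 (0, u2))); rewrite !gK => -[e].
by rewrite -e eqxx in nz2.
Qed.

End KraftModules.

(** * Modules of the first kind *)

Lemma converse_arrow_inj (T : finType) : injective (@converse_arrow T).
Proof. by move=> [[x y] []] [[z t] []] //= [-> ->]. Qed.

Lemma converse_arrowF (G : lgraph label) x y :
  ((x, y, LF) \in arrows G) = ((x, y, WF) \in arrows (converse G)).
Proof. by rewrite -(mem_imset _ _ (@converse_arrow_inj _)). Qed.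

Lemma converse_arrowV (G : lgraph label) x y :
  ((x, y, LV) \in arrows G) = ((y, x, WVs) \in arrows (converse G)).
Proof. by rewrite -(mem_imset _ _ (@converse_arrow_inj _)). Qed.

Section Transport.

Context {K : fieldType} {sigma tau : {rmorphism K -> K}}.
Context (sigma_bij : bijective sigma) (tau_bij : bijective tau).

Lemma iso_pre (M N : twisted_module sigma tau) (f : {linear M -> N}) s
    (X : {vspace M}) (Y : {vspace N}) :
  bijective f -> (forall x, f (opF x) = opF (f x)) ->
  (forall x, f (opV x) = opV (f x)) ->
  (forall x, x \in X <-> f x \in Y) -> forall x, x \in pre s X <-> f x \in pre s Y.
Proof.
move=> [g fK gK] fF fV XY; elim: s => [|a s IH] //= x.
have fD z y : D_letter a z y <-> D_letter a (f z) (f y).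
  by case: a; rewrite /= -?fF -?fV; split=> [->|/(can_inj fK)].
rewrite !(mem_act tau_bij); split=> [[y /IH ys /fD xy]|[y]]; first by exists (f y).
by rewrite -[y]gK => /IH ys /fD xy; exists (g y).
Qed.

Lemma iso_gapped (M N : twisted_module sigma tau) s :
  isomorphic_modules M N -> gapped M s -> gapped N s.
Proof.
case=> f [fb fF fV] /subvPn[x xB xA].
have kerE y : y \in kerF <-> f y \in kerF.
  apply: (@iso_pre _ _ _ [:: WF] _ _ fb fF fV) => z.
  by rewrite !memv0 -(inj_eq (bij_inj fb)) linear0.
have imE y : y \in imV <-> f y \in imV.
  by apply: (@iso_pre _ _ _ [:: WVs] _ _ fb fF fV) => z; rewrite !memvf.
apply/subvPn; exists (f x); first exact: (iso_pre s fb fF fV kerE x).1.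
by apply: contra xA; exact: (iso_pre s fb fF fV imE x).2.
Qed.

End Transport.

Section FirstKind.

Context {K : fieldType} {sigma tau : {rmorphism K -> K}}.
Context (sigma_bij : bijective sigma) (tau_bij : bijective tau).
Context {M : twisted_module sigma tau}.

(** An elementary interval that is no gap of a suffix of [s] could be inserted between these gaps,
    giving more than [\dim {:M}] ordered non-zero intervals. *)
Lemma first_kind_gapped s : gapped M s -> (size s).+1 = \dim {:M} -> first_kind M.
Proof.
move=> gs ds N N' [beta [[_ _ sorted_beta mem_beta beta_mem] [i [ib -> ->]]]].
set X := nth 0%VS beta i; set Y := nth 0%VS beta i.+1.
have chain Z : Z \in beta -> in_chain Z.
  move=> /beta_mem[w [] Zw]; exists (rev w); [left|right].
    by apply/vspaceP => x; apply/idP/idP => [/Zw/(mem_ker tau_bij)|/(mem_ker tau_bij)/Zw].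
  by apply/vspaceP => x; apply/idP/idP => [/Zw/(mem_dom tau_bij)|/(mem_dom tau_bij)/Zw].
have lt_nth j k : (j < k < size beta)%N -> (nth 0%VS beta j <= nth 0%VS beta k)%VS
    && (nth 0%VS beta j != nth 0%VS beta k).
  by move=> /andP[jk ks]; apply: (sorted_ltn_nth strict_subv_trans) => //;
    rewrite inE ?(ltn_trans jk).
have /andP[leXY neXY] : (X <= Y)%VS && (X != Y) by apply: lt_nth; rewrite ltnSn.
have Xb : X \in beta by rewrite mem_nth // ltnW.
have Yb : Y \in beta by rewrite mem_nth.
have between Z : Z \in beta -> (X <= Z)%VS -> (Z <= Y)%VS -> Z = X \/ Z = Y.
  move=> /(nthP 0%VS)[j jb <-] XZ ZY.
  case: (ltngtP j i) => [ji|ij|->]; [|right|by left].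
    left; apply/eqP; rewrite eqEsubv XZ andbT.
    by have /andP[] := lt_nth j i (introT andP (conj ji (ltnW ib))).
  have [-> //|ne] := eqVneq j i.+1.
  have ij' : (i.+1 < j)%N by rewrite ltn_neqAle eq_sym ne.
  apply/eqP; rewrite eqEsubv ZY.
  by have /andP[] := lt_nth i.+1 j (introT andP (conj ij' jb)).
have in_beta u : (pre u imV \in beta) /\ (pre u kerF \in beta).
  have [_ [Z Zb ZP]] := mem_beta (WVs :: rev u).
  have [[Z' Zb' ZP'] _] := mem_beta (WF :: rev u).
  split; [suff -> : pre u imV = Z by []|suff -> : pre u kerF = Z' by []].
    apply/vspaceP => x; rewrite -[u]revK.
    by apply/idP/idP => [/(mem_domV tau_bij)/ZP|/ZP/(mem_domV tau_bij)].
  apply/vspaceP => x; rewrite -[u]revK.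
  by apply/idP/idP => [/(mem_kerFw tau_bij)/ZP'|/ZP'/(mem_kerFw tau_bij)].
have [[k [kA kB]]|noX] := pselect (exists k : 'I_(size s).+1,
    pre (drop k s) imV = X /\ pre (drop k s) kerF = Y).
  exists (rev (drop k s)); split.
  - split=> [x /(mem_domV tau_bij)|].
      rewrite revK kA => /(subvP leXY); rewrite -kB => xY.
      by apply/(mem_kerFw tau_bij); rewrite revK.
    move=> h; have /negP := gapped_drop tau_bij k gs; apply; apply/subvP => x xB.
    have /h/(mem_domV tau_bij) : rel_ker (D (WF :: rev (drop k s))) x.
      by apply/(mem_kerFw tau_bij); rewrite revK.
    by rewrite revK.
  - by move=> x; rewrite -/X -kA -[X in pre X]revK; split=> /(mem_domV tau_bij).
  - by move=> x; rewrite -/Y -kB -[X in pre X]revK; split=> /(mem_kerFw tau_bij).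
exfalso.
pose A (o : option 'I_(size s).+1) := if o is Some k then pre (drop k s) imV else X.
pose B (o : option 'I_(size s).+1) := if o is Some k then pre (drop k s) kerF else Y.
suff : (#|{: option 'I_(size s).+1}| <= \dim {:M})%N.
  by rewrite card_option card_ord -ds ltnn.
(* By [chain_gap], a gap neither below [X] nor above [Y] lies between [X] and [Y]; consecutivity
   then makes it the interval itself. *)
have XYk (k : 'I_(size s).+1) :
    (pre (drop k s) kerF <= X)%VS \/ (Y <= pre (drop k s) imV)%VS.
  have [XA|] := chain_gap tau_bij (drop k s) (chain _ Xb); last by left.
  have [|BY] := chain_gap tau_bij (drop k s) (chain _ Yb); first by right.
  have [Ab Bb] := in_beta (drop k s).
  have AB := gap_le tau_bij (M := M) (drop k s).
  have nBA := gapped_drop tau_bij k gs.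
  have [Ak|Ak] := between _ Ab XA (subv_trans AB BY); last first.
    by case/negP: nBA; rewrite Ak.
  have [Bk|Bk] := between _ Bb (subv_trans XA AB) BY; first by rewrite Bk; left.
  by case: noX; exists k.
apply: (@flag_card _ _ _ A B) => [[k|]|[k|]|[j|] [k|] jk] //=.
- exact: gap_le.
- exact: gapped_drop.
- by apply: contra neXY => YX; rewrite eqEsubv leXY.
- by apply: gap_ord => //; apply: contra_neq jk => /drop_inj->.
- by case: (XYk k); [right|left].
Qed.

End FirstKind.

(** * Existence of the stabilized sequence, and exclusivity of the kinds *)

Section StabilizedSequence.

Context {K : fieldType} {sigma tau : {rmorphism K -> K}}.
Context (tau_bij : bijective tau).
Context {M : twisted_module sigma tau}.

Let lt (N N' : {vspace M}) := (N <= N')%VS && (N != N').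

(** The chain is totally ordered, so it has at most one member of each dimension; append it when it
    exists. *)
Lemma chain_enum k : exists beta : seq {vspace M}, pairwise lt beta /\
  forall Z, Z \in beta <-> in_chain Z /\ (\dim Z < k)%N.
Proof.
elim: k => [|k [beta [sb bP]]]; first by exists [::]; split=> // Z; split=> // -[].
have [[Z [cZ dZ]]|noZ] := pselect (exists Z : {vspace M}, in_chain Z /\ \dim Z = k).
  exists (rcons beta Z); split=> [|Z'].
    rewrite pairwise_rcons sb andbT; apply/allP => Z' /bP[cZ' dZ'].
    have neZ : Z' != Z by apply: contraTneq dZ' => ->; rewrite dZ ltnn.
    rewrite /lt neZ andbT.
    case: (chain_total tau_bij cZ cZ') => // /dimvS; rewrite dZ leqNgt.
    by rewrite dZ'.
  rewrite mem_rcons inE; split=> [/predU1P[->|/bP[cZ' dZ']]|[cZ' dZ']].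
  - by rewrite dZ ltnSn.
  - by split=> //; exact: ltnW.
  move: dZ'; rewrite ltnS leq_eqVlt => /predU1P[dZ'|dZ']; last first.
    by apply/orP; right; apply/bP.
  apply/orP; left; case: (chain_total tau_bij cZ cZ') => le.
    by rewrite eq_sym eqEdim le dZ dZ' leqnn.
  by rewrite eqEdim le dZ dZ' leqnn.
exists beta; split=> // Z; split=> [/bP[cZ dZ]|[cZ dZ]].
  by split=> //; exact: ltnW.
apply/bP; split=> //; move: dZ; rewrite ltnS leq_eqVlt => /predU1P[dZ|//].
by case: noZ; exists Z.
Qed.

Lemma stabilized_ex : exists beta : seq {vspace M},
  stabilized_sequence beta /\ forall Z, Z \in beta <-> in_chain Z.
Proof.
have [beta [sb bP]] := chain_enum (\dim {:M}).+1.
have {}bP Z : Z \in beta <-> in_chain Z.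
  by rewrite bP ltnS (dimvS (subvf Z)); split=> [[]|].
exists beta; split=> //; split.
- have : 0%VS \in beta by apply/bP; exact: chain0.
  case: beta sb {bP} => [|X beta] //= /andP[/allP h _] /predU1P[<-//|/h/andP[X0 _]].
  by apply/eqP; rewrite -subv0.
- have : fullv \in beta by apply/bP; exact: chain1.
  case/lastP: beta sb {bP} => [|beta X] //=; rewrite pairwise_rcons last_rcons mem_rcons.
  move=> /andP[/allP h _] /predU1P[<-//|/h/andP[X0 _]].
  by apply/eqP; rewrite eqEsubv subvf.
- by rewrite (sorted_pairwise strict_subv_trans).
- move=> w; split.
    exists (pre (rev w) 0%VS); first by apply/bP; exists (rev w); left.
    by move=> x; split=> /(mem_ker tau_bij).
  exists (pre (rev w) fullv); first by apply/bP; exists (rev w); right.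
  by move=> x; split=> /(mem_dom tau_bij).
move=> N /bP[s [->|->]]; exists (rev s); [left|right]; rewrite -[X in pre X]revK => x.
  by split=> /(mem_ker tau_bij).
by split=> /(mem_dom tau_bij).
Qed.

(** A non-zero module has at least one elementary interval. *)
Lemma kinds_exclusive : (fullv : {vspace M}) != 0%VS -> ~ (first_kind M /\ second_kind M).
Proof.
move=> nz [fk sk]; have [beta [sb bP]] := stabilized_ex.
have size_beta : (1 < size beta)%N.
  case: sb => b0 b1 _ _ _; move: b0 b1 nz; case: (beta) => [|X [|Y b]] //=.
    by move=> -> _; rewrite eqxx.
  by move=> -> <-; rewrite eqxx.
have el : elementary_interval (nth 0%VS beta 0) (nth 0%VS beta 1).
  by exists beta; split=> //; exists 0%N.
exact: (sk _ _ el (fk _ _ el)).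
Qed.

Lemma second_kind_exact : (kerF <= (imV : {vspace M}))%VS -> second_kind M.
Proof.
move=> ex N N' _ [w [[_ h] _ _]]; apply: h => x /(mem_kerFw tau_bij) xk.
by apply/(mem_domV tau_bij); apply: (subvP (pre_mono tau_bij _ ex)).
Qed.

End StabilizedSequence.

(** * Existence of the linear quiver *)

Section StringModules.

Context {K : fieldType} {sigma tau : {rmorphism K -> K}}.
Context (sigma_bij : bijective sigma) (tau_bij : bijective tau).

Section Existence.

Context {M : twisted_module sigma tau} (M_indec : indecomposable_module M).

(** The empty word is gapped, and extending to the left stops by [gapped_size]. *)
Lemma gapped_longest : ~~ (kerF <= (imV : {vspace M}))%VS -> exists s,
  [/\ gapped M s, ~~ gapped M (WF :: s) & ~~ gapped M (WVs :: s)].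
Proof.
move=> g0.
suff H k : forall s, (\dim {:M} - size s <= k)%N -> gapped M s -> exists s,
    [/\ gapped M s, ~~ gapped M (WF :: s) & ~~ gapped M (WVs :: s)].
  by apply: (H _ [::] (leqnn _)).
elim: k => [|k IH] s; first by rewrite leqn0 subn_eq0 leqNgt => /negP h /(gapped_size tau_bij).
move=> ds gs; have [gF|nF] := boolP (gapped M (WF :: s)).
  by apply: IH gF; rewrite /= subnS; move: ds; case: (_ - _)%N.
have [gV|nV] := boolP (gapped M (WVs :: s)).
  by apply: IH gV; rewrite /= subnS; move: ds; case: (_ - _)%N.
by exists s.
Qed.

(** Let [A] and [B] be the lower and upper ends of the gap of a longest [s]. Suppose every element
    of [B] killed by [V] is in [A + F M]. As [WVs :: s] has no gap, any [x] in [B] can be changed by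
    an element of [A] into one killed by [V], so it is some [F y] modulo [A]; as [WF :: s] has no
    gap, [F y] is in [A]. Then [B] lies in [A], a contradiction. *)
Lemma string_start : ~~ (kerF <= (imV : {vspace M}))%VS ->
  exists s x (f : {linear M -> K^o}), [/\ gapped M s, x \in pre s kerF, opV x = 0, f x = 1
    & (forall y, f (opF y) = 0) /\ (forall y, y \in pre s imV -> f y = 0)].
Proof.
move=> /gapped_longest[s [gs nF nV]]; exists s.
pose Z := vspace_of (fun x : M => exists y, x = opF y).
have memZ x : x \in Z <-> exists y, x = opF y.
  apply: vspace_ofP; split; first by exists 0; rewrite linear0.
  have [si siK sKi] := sigma_bij.
  by move=> c _ _ [y ->] [z ->]; exists (si c *: y + z); rewrite linearD opFZ sKi.
have [x [xB Vx xZ]] : exists x : M, [/\ x \in pre s kerF, opV x = 0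
    & x \notin (pre s imV + Z)%VS].
  apply: contrapT => no.
  case/negP: gs; apply/subvP => x xB.
  have : opV x \in act WVs (pre s imV).
    move: nV; rewrite negbK => /subvP; apply; apply/(mem_actV tau_bij).
    by exists x.
  move=> /(mem_actV tau_bij)[a aA Vxa].
  have aB := subvP (gap_le tau_bij s) _ aA.
  have : x - a \in (pre s imV + Z)%VS.
    apply/negPn/negP => h; apply: no; exists (x - a).
    by rewrite rpredB // linearB Vxa subrr.
  move=> /memv_addP[b bA [_ /memZ[y ->] xaby]].
  have bB := subvP (gap_le tau_bij s) _ bA.
  have yB : y \in act WF (pre s kerF).
    apply/mem_actF; have -> : opF y = x - a - b by rewrite xaby addrAC subrr add0r.
    by rewrite !rpredB.
  have yA : y \in act WF (pre s imV) by move: nF; rewrite negbK => /subvP; apply.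
  rewrite -[x](subrK a) xaby; rewrite !rpredD //; exact/mem_actF.
have [f [fx f0]] := separating_functional xZ.
exists x, f; split=> //; split=> [y|y yA]; apply: f0.
  by apply: (subvP (addvSr _ _)); apply/memZ; exists y.
exact: (subvP (addvSl _ _)).
Qed.

(** [ordS] wraps around at the last vertex; the index set leaves this vertex out, so no arrow closes
    the cycle. *)
Definition string_quiver (s : seq letter) : kraft_quiver :=
  quiver [set i : 'I_(size s).+1 | (i.+1 < (size s).+1)%N] (nth WF s \o val)
    (can_inj (@ordSK (size s).+1)).

Lemma string_quiver_linear s : linear_graph (string_quiver s).
Proof.
have cT : #|vertex (string_quiver s)| = (size s).+1 by exact: card_ord.
split; first by rewrite cT.
exists (cast_ord cT), (nth WF s \o val); split.
  by exists (cast_ord (esym cT)); [exact: cast_ordK|exact: cast_ordKV].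
rewrite quiver_converse; apply/setP => x; apply/imsetP/imsetP => -[i]; rewrite inE => iE ->.
  exists (cast_ord (esym cT) i); first by rewrite inE; exact: leq_trans iE (eq_leq (esym cT)).
  by rewrite cast_ordKV; congr (_, _, _); apply/val_inj; congr (_ %% _)%N.
exists (cast_ord cT i); first by rewrite inE; exact: leq_trans iE (eq_leq cT).
by congr (_, _, _); apply/val_inj; congr (_ %% _)%N.
Qed.

Lemma string_existence : ~~ (kerF <= (imV : {vspace M}))%VS ->
  exists s, [/\ gapped M s, (size s).+1 = \dim {:M} &
    let G := string_quiver s in
    [/\ connected_graph G, linear_graph G
      & isomorphic_modules M (kraft_module (trivial_rep sigma tau G))]].
Proof.
move=> /string_start[s [x [f [gs xB Vx fx [f0 fA]]]]]; exists s.
have [e [e0 eD eB]] := walk tau_bij xB.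
have [g [g0 gD gA]] := dual_walk sigma_bij tau_bij fA.
have Ve : opV (e 0%N) = 0 by rewrite e0.
have gF y : g 0%N (opF y) = 0 by rewrite g0.
have ge : g 0%N (e 0%N) != 0 by rewrite g0 e0 fx oner_eq0.
have dM := string_dim tau_bij M_indec eD eB gD gA Ve gF ge.
have full := string_full tau_bij M_indec eD eB gD gA Ve gF ge.
have free := string_free tau_bij eD eB gD gA ge.
split=> // G; set U := trivial_rep sigma tau G.
suff MU : isomorphic_modules M (kraft_module U).
  split=> //; last exact: string_quiver_linear.
  apply: (indecomposable_connected M_indec MU) => v; exists (1 : K^o).
  exact: oner_neq0.
have iL (v : vertex G) : linear (fun c : K^o => c *: e (v : 'I__)).
  by move=> a c d; rewrite scalerDl scalerA.
pose i (v : vertex G) : {linear U v -> M} := HB.pack (fun c : K^o => c *: e (v : 'I__))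
   (GRing.isLinear.Build K K^o M _ _ (iL v)).
apply: (@kraft_module_iso _ _ _ G U M i).
- move=> [[[v w] [] vw] c] /=; rewrite /label_of /tail_of /head_of /= in c *.
    rewrite opFZ; congr (_ *: _).
    move: vw; rewrite quiver_arrowF inE ltnS => /and3P[vE lv /eqP->].
    by rewrite (string_opF eD eB) ?(ltnW vE) // vE lv /= modn_small.
  rewrite opVZ; congr (_ *: _).
  move: vw; rewrite quiver_arrowV inE ltnS => /and3P[vE lv /eqP->].
  by rewrite /= modn_small // (string_opVS eD) // lv.
- move=> [] v c nw /=; rewrite ?opFZ ?opVZ.
    rewrite (string_opF eD eB (ltn_ord v)); case: ifP => [/andP[vE lv]|]; last by rewrite scaler0.
    by have := nw (ordS v); rewrite quiver_arrowF inE ltnS vE lv eqxx.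
  case: v c nw => -[|v] vs c nw /=; first by rewrite Ve scaler0.
  rewrite (string_opVS eD) //; case: ifP => [lv|]; last by rewrite scaler0.
  have := nw (Ordinal (ltnW vs)); rewrite quiver_arrowV inE vs lv.
  by rewrite -val_eqE /= modn_small // eqxx.
- move=> c c0; apply/dsumP => v; rewrite dsum0; exact: (free (fun v => c v)).
move=> y; have : y \in <<codom (fun k : 'I_(size s).+1 => e k)>>%VS by rewrite full memvf.
move=> /span_codom[c ->]; exists (dsum_of (c : forall v, U v)).
by apply: eq_bigr => v _; rewrite dsum_ofE.
Qed.

End Existence.

End StringModules.

(** * Reading the word back from a linear quiver *)

Section StringWord.

Context {K : fieldType} {sigma tau : {rmorphism K -> K}}.
Context (tau_bij : bijective tau).
Context (G : kraft_quiver).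
Let n := #|vertex G|.
Context (v : 'I_n -> vertex G) (l : 'I_n -> letter) (G_lin : linear_enum v l).
Let U := trivial_rep sigma tau G.
Let N := kraft_module U.

Lemma trivial_rep_dim : \dim {:N} = n.
Proof.
pose e (u : vertex G) : N := @dsum_in _ _ U u (1 : K^o).
have eE (c : vertex G -> K) : \sum_u c u *: e u = (dsum_of (c : forall u, U u) : dsum U).
  rewrite [RHS]dsum_inE; apply: eq_bigr => u _.
  rewrite dsum_ofE /e -linearZ; congr dsum_in; exact: mulr1.
have free_e (c : vertex G -> K) : \sum_u c u *: e u = 0 -> forall u, c u = 0.
  move=> c0 u; have := congr1 (fun x : dsum U => x u) c0.
  by rewrite eE dsum_ofE => ->; exact: (dsum0 U u).
rewrite -[n]/(#|vertex G|) -(free_family free_e); congr (\dim _); apply/eqP.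
rewrite eqEsubv subvf andbT; apply/subvP => x _.
have -> : x = \sum_u (x : dsum U) u *: e u.
  by rewrite eE; apply/dsumP => u; rewrite dsum_ofE.
by apply: rpred_sum => u _; apply/rpredZ/memv_span/codomP; exists u.
Qed.

Let E i j a : ((i, j, a) \in arrows (converse G)) ->
  exists k : 'I_n, [/\ (k.+1 < n)%N, i = v k, j = v (ordS k) & a = l k].
Proof.
by case: G_lin => _ ->; case/imsetP => k; rewrite inE => kn [-> -> ->]; exists k.
Qed.

Let Ein (k : 'I_n) : (k.+1 < n)%N -> (v k, v (ordS k), l k) \in arrows (converse G).
Proof. by move=> kn; case: G_lin => _ ->; apply/imsetP; exists k; rewrite ?inE. Qed.

(** One letter fewer than vertices; the default [WF] is never reached below [n.-1]. *)
Definition string_word := mkseq (fun k => if insub k is Some i then l i else WF) n.-1.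

Lemma size_string_word : size string_word = n.-1.
Proof. by rewrite size_mkseq. Qed.

Lemma nth_string_word (k : 'I_n) : (k.+1 < n)%N -> nth WF string_word k = l k.
Proof.
by move=> kn; rewrite nth_mkseq ?valK // -ltnS prednK // (leq_ltn_trans _ kn).
Qed.

Let ev k : dsum U := @dsum_in _ _ U (v k) (1 : K^o).

Let ev_step (k : 'I_n) : (k.+1 < n)%N -> D_letter (M := N) (l k) (ev k) (ev (ordS k)).
Proof.
move=> /Ein; case lk: (l k); [rewrite -converse_arrowF|rewrite -converse_arrowV] => h.
  pose e : arrow G := exist _ (v k, v (ordS k), LF) h; symmetry.
  apply: etrans (@graph_op_in _ _ _ _ U e 1) _.
  congr dsum_in; exact: rmorph1.
pose e : arrow G := exist _ (v (ordS k), v k, LV) h; symmetry.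
apply: etrans (@graph_op_in _ _ _ _ U e 1) _.
congr dsum_in; exact: rmorph1.
Qed.

Let coord_step (k : 'I_n) (x y : N) : (k.+1 < n)%N -> D_letter (l k) x y ->
  (y : dsum U) (v (ordS k)) = 0 -> (x : dsum U) (v k) = 0.
Proof.
move=> /Ein; case lk: (l k); [rewrite -converse_arrowF|rewrite -converse_arrowV] => h xy y0.
  pose e : arrow G := exist _ (v k, v (ordS k), LF) h.
  have := @graph_op_head _ _ _ _ U e x; rewrite -[graph_op _ _]xy [LHS]y0.
  by move=> /esym/eqP; rewrite fmorph_eq0 => /eqP.
pose e : arrow G := exist _ (v (ordS k), v k, LV) h.
have := @graph_op_head _ _ _ _ U e y; rewrite -[graph_op _ _]xy => ->.
by rewrite [X in rep_map _ _ X]y0 linear0.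
Qed.

Let v_inj : injective v. Proof. by case: G_lin => /bij_inj. Qed.

(** Induction from the end of the string, with [d] the distance to it. The last vertex emits no
    F-arrow and receives no V-arrow; each move to the left carries both claims through one arrow. *)
Let string_tail d (k : 'I_n) : (k + d = n.-1)%N ->
  (ev k : N) \in pre (drop k string_word) kerF /\
  forall x : N, x \in pre (drop k string_word) imV -> (x : dsum U) (v k) = 0.
Proof.
elim: d k => [|d IH] k kd.
  have kn : k.+1 = n by rewrite -[k : nat]addn0 kd prednK // (leq_ltn_trans _ (ltn_ord k)).
  rewrite drop_oversize ?size_string_word -?kd ?addn0 //; split.
    apply/mem_kerF; apply: (@graph_op_in0 _ _ _ _ U) => w.
    rewrite converse_arrowF; apply/negP => /E[j [jn /v_inj kj _ _]].
    by move: jn; rewrite -kj kn ltnn.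
  move=> x /(mem_imV tau_bij)[y ->]; apply: (@graph_op_head0 _ _ _ _ U) => w.
  rewrite converse_arrowV; apply/negP => /E[j [jn /v_inj kj _ _]].
  by move: jn; rewrite -kj kn ltnn.
have kn : (k.+1 < n)%N by lia.
have Sk : ordS k = k.+1 :> nat by rewrite /= modn_small.
have [ek xk] := IH (ordS k) (etrans (congr1 (addn^~ d) Sk) (etrans (addSnnS _ _) kd)).
rewrite Sk in ek xk.
rewrite (drop_nth WF) ?size_string_word; last by lia.
rewrite nth_string_word //; split.
  by apply/(mem_act tau_bij); exists (ev (ordS k)) => //; exact: ev_step.
by move=> x /(mem_act tau_bij)[y /xk y0 xy]; apply: coord_step xy y0.
Qed.

Lemma string_word_gapped : (0 < n)%N -> gapped N string_word.
Proof.
move=> n0; have [e0 x0] := @string_tail n.-1 (Ordinal n0) erefl.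
move: e0 x0; rewrite drop0 => eB xA; apply/subvPn; exists (ev (Ordinal n0)) => //.
apply/negP => /xA; rewrite dsum_in_eq => /eqP; apply/negP; exact: oner_neq0.
Qed.

End StringWord.

Section StringUnique.

Context {K : fieldType} {sigma tau : {rmorphism K -> K}}.
Context (tau_bij : bijective tau).

(** Both words are gapped in [M] and have the length fixed by its dimension, so [gapped_unique]
    identifies them. *)
Lemma string_unique (M : twisted_module sigma tau) (G G' : kraft_quiver) :
  linear_graph G -> isomorphic_modules M (kraft_module (trivial_rep sigma tau G)) ->
  linear_graph G' -> isomorphic_modules M (kraft_module (trivial_rep sigma tau G')) ->
  isomorphic_graphs G G'.
Proof.
move=> [n0 [v [l Gl]]] MG [n0' [v' [l' Gl']]] MG'.
have nE : #|vertex G| = #|vertex G'|.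
  rewrite -(trivial_rep_dim (sigma := sigma) (tau := tau) G).
  rewrite -(trivial_rep_dim (sigma := sigma) (tau := tau) G').
  by rewrite -(isomorphic_modules_dim MG) -(isomorphic_modules_dim MG').
have gs := iso_gapped tau_bij (isomorphic_modules_sym MG) (string_word_gapped tau_bij Gl n0).
have gs' := iso_gapped tau_bij (isomorphic_modules_sym MG') (string_word_gapped tau_bij Gl' n0').
have ss : string_word l' = string_word l.
  apply: (gapped_unique tau_bij gs gs'); rewrite !size_string_word ?nE //.
  by rewrite prednK // (isomorphic_modules_dim MG') trivial_rep_dim.
have ll (k : 'I_#|vertex G|) : (k.+1 < #|vertex G|)%N -> l' (cast_ord nE k) = l k.
  move=> kn; rewrite -(nth_string_word l kn) -ss.
  by rewrite -(nth_string_word (k := cast_ord nE k) l') //= -nE.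
have [[w vK wK] arrG] := Gl; have [[w' vK' wK'] arrG'] := Gl'.
pose f x := v' (cast_ord nE (w x)).
have fb : bijective f.
  exists (fun y => v (cast_ord (esym nE) (w' y))) => x.
    by rewrite /f vK' cast_ordK wK.
  by rewrite /f vK cast_ordKV wK'.
have fE x y a : ((f x, f y, a) \in arrows (converse G')) = ((x, y, a) \in arrows (converse G)).
  rewrite arrG arrG'.
  have ordSE k : cast_ord nE (ordS k) = ordS (cast_ord nE k).
    by apply/val_inj => /=; congr (_ %% _)%N.
  apply/imsetP/imsetP => -[k]; rewrite inE => kn [].
    move=> /(can_inj vK') xk /(can_inj vK') yk ->.
    have kn' : ((cast_ord (esym nE) k).+1 < #|vertex G|)%N by rewrite /= nE.
    exists (cast_ord (esym nE) k); first by rewrite inE.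
    rewrite -ll // cast_ordKV -[k in ordS k](cast_ordKV nE) in yk *.
    rewrite -ordSE in yk.
    by rewrite -(cast_ord_inj yk) -xk cast_ordK !wK.
  move=> -> -> ->; exists (cast_ord nE k); first by rewrite inE /= -nE.
  by rewrite /f !vK ordSE ll.
constructor; apply: (@GraphIso _ G G' f fb) => x y [].
  by rewrite !converse_arrowF fE.
by rewrite !converse_arrowV fE.
Qed.

End StringUnique.

(** * Modules with Ker F = Im V *)

Section SkewLinear.

Context {K : fieldType}.

(** The scalar law is existentially quantified so that walks mixing different twists stay in one
    class closed under composition. *)
Definition skewlinear (V W : lmodType K) (f : V -> W) : Prop :=
  exists2 s : K -> K, bijective s & forall c x y, f (c *: x + y) = s c *: f x + f y.

Lemma skewlinear_comp (V W X : lmodType K) (f : V -> W) (g : W -> X) :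
  skewlinear f -> skewlinear g -> skewlinear (g \o f).
Proof.
move=> [s sb fL] [t tb gL]; exists (t \o s); first exact: bij_comp.
by move=> c x y /=; rewrite fL gL.
Qed.

Lemma skewlinear0 (V W : lmodType K) (f : V -> W) : skewlinear f -> f 0 = 0.
Proof.
move=> [s [t sK tK] fL]; have := fL (t (-1)) 0 0; rewrite tK scaler0 addr0.
by rewrite scaleN1r addNr.
Qed.

Lemma skewlinearD (V W : lmodType K) (f : V -> W) x y : skewlinear f ->
  f (x + y) = f x + f y.
Proof.
move=> fs; have f0 := skewlinear0 fs; move: fs => [s sb fL].
have s1 z : s 1 *: f z = f z by have := fL 1 z 0; rewrite scale1r !addr0 f0 addr0.
by have := fL 1 x y; rewrite scale1r s1.
Qed.

Lemma skewlinearZ (V W : lmodType K) (f : V -> W) : skewlinear f ->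
  exists2 s : K -> K, bijective s & forall c x, f (c *: x) = s c *: f x.
Proof.
move=> fs; have f0 := skewlinear0 fs; move: fs => [s sb fL].
by exists s => // c x; have := fL c x 0; rewrite f0 !addr0.
Qed.

Lemma skewlinear_sum (V W : lmodType K) (f : V -> W) (I : finType) (e : I -> V) :
  skewlinear f -> f (\sum_i e i) = \sum_i f (e i).
Proof.
by move=> fs; exact: (big_morph f (fun x y => skewlinearD x y fs) (skewlinear0 fs)).
Qed.

Lemma skewlinear_image (V W : vectType K) (f : V -> W) (X : {vspace V}) :
  skewlinear f -> subspace_pred (fun y => exists2 x, x \in X & y = f x).
Proof.
move=> fs; split; first by exists 0; rewrite ?mem0v ?skewlinear0.
move: fs => [s [t sK tK] fL] a _ _ [x xX ->] [y yX ->].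
by exists (t a *: x + y); rewrite ?fL ?tK // memvD // memvZ.
Qed.

Lemma skewlinear_dim_inj (V W : vectType K) (f : V -> W) (X : {vspace V}) (Y : {vspace W}) :
  skewlinear f -> (forall x, x \in X -> f x \in Y) ->
  (forall x, x \in X -> f x = 0 -> x = 0) -> (\dim X <= \dim Y)%N.
Proof.
move=> fs fXY inj; pose e (i : 'I_(\dim X)) := f (vbasis X)`_i.
have [s [t sK tK] fZ] := skewlinearZ fs.
have bX i : (vbasis X)`_i \in X.
  have [iX|Xi] := ltnP i (\dim X); first by rewrite vbasis_mem ?mem_nth ?size_tuple.
  by rewrite nth_default ?mem0v // size_tuple.
have fr (c : 'I_(\dim X) -> K) : \sum_i c i *: e i = 0 -> forall i, c i = 0.
  move=> c0 i; have /freeP h := basis_free (vbasisP X).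
  have tc : \sum_i t (c i) *: (vbasis X)`_i = 0.
    apply: inj; first by apply: rpred_sum => j _; rewrite rpredZ.
    by rewrite (skewlinear_sum _ fs) -[RHS]c0; apply: eq_bigr => j _; rewrite fZ tK.
  have ci0 : c i *: e i = 0.
    by rewrite -(tK (c i)) -fZ (h _ tc i) scale0r (skewlinear0 fs).
  move/eqP: ci0; rewrite scaler_eq0 => /predU1P[//|/eqP /(inj _ (bX i)) bi0].
  have := free_not0 (basis_free (vbasisP X)) (mem_nth 0 (_ : i < size (vbasis X))%N).
  by rewrite size_tuple ltn_ord bi0 eqxx => /(_ isT).
have eY : (<<codom e>> <= Y)%VS.
  by apply/span_subvP => _ /codomP[i ->]; exact: fXY.
by move/dimvS: eY; rewrite (free_family fr) card_ord.
Qed.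

Lemma skewlinear_dim_onto (V W : vectType K) (f : V -> W) (X : {vspace V}) (Y : {vspace W}) :
  skewlinear f -> (forall y, y \in Y -> exists2 x, x \in X & y = f x) ->
  (\dim Y <= \dim X)%N.
Proof.
move=> fs onto; have [s sb fZ] := skewlinearZ fs.
have : (Y <= <<map f (vbasis X)>>)%VS.
  apply/subvP => _ /onto[x xX ->]; rewrite (coord_vbasis xX) (skewlinear_sum _ fs).
  apply: rpred_sum => i _; rewrite fZ; apply/rpredZ/memv_span/map_f.
  by rewrite mem_nth ?size_tuple.
move/dimvS/leq_trans; apply; rewrite (leq_trans (dim_span _)) //.
by rewrite size_map size_tuple.
Qed.

End SkewLinear.

(** * Exactness at [V] from exactness at [F] *)

Section ExactKernels.

Context {K : fieldType} {sigma tau : {rmorphism K -> K}}.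
Context (sigma_bij : bijective sigma) (tau_bij : bijective tau).
Context {M : twisted_module sigma tau}.

Lemma opF_skewlinear : skewlinear (@opF _ _ _ M).
Proof. by exists sigma => // c x y; rewrite linearD opFZ. Qed.

Lemma opV_skewlinear : skewlinear (@opV _ _ _ M).
Proof. by exists tau => // c x y; rewrite linearD opVZ. Qed.

(** Rank count: [F M] lies in [Ker V], and its codimension is at most [\dim kerF], which is at most
    [\dim imV], hence at most the codimension of [Ker V]. Complements of the kernels carry the
    ranks. *)
Lemma exact_kerV : (kerF <= (imV : {vspace M}))%VS ->
  forall x : M, opV x = 0 -> exists y, x = opF y.
Proof.
move=> ex x Vx.
pose Z := vspace_of (fun x : M => exists2 y, y \in fullv & x = opF y).
have memZ z : z \in Z <-> exists2 y, y \in fullv & z = opF y.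
  exact: vspace_ofP (skewlinear_image _ opF_skewlinear).
pose Y : {vspace M} := vspace_of (fun x : M => opV x = 0).
have memY z : z \in Y <-> opV z = 0.
  apply: vspace_ofP; split; first by rewrite linear0.
  by move=> c a b a0 b0; rewrite linearD opVZ a0 b0 scaler0 addr0.
have dimC (X : {vspace M}) : (\dim X^C + \dim X)%N = \dim {:M}.
  by rewrite addnC -dimv_disjoint_sum ?capv_compl // addv_complf.
have capC (X : {vspace M}) z : z \in X -> z \in X^C%VS -> z = 0.
  by move=> zX zC; apply/eqP; rewrite -memv0 -(capv_compl X) memv_cap zX.
have dF : (\dim (kerF : {vspace M})^C <= \dim Z)%N.
  apply: (skewlinear_dim_inj opF_skewlinear) => z zC; first by apply/memZ; exists z; rewrite ?memvf.
  by move=> /mem_kerF zk; exact: capC zC.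
have dV : (\dim (imV : {vspace M}) <= \dim Y^C)%N.
  apply: (skewlinear_dim_onto opV_skewlinear) => _ /(mem_imV tau_bij)[z ->].
  have /memv_addP[a aY [b bC zab]] : z \in (Y + Y^C)%VS by rewrite addv_complf memvf.
  by exists b; rewrite // zab linearD (memY a).1 // add0r.
have /eqP ZY : Z == Y.
  rewrite eqEdim; apply/andP; split.
    by apply/subvP => _ /memZ[z _ ->]; apply/memY; rewrite opVF0.
  rewrite -(leq_add2l (\dim Y^C)) dimC -(dimC kerF) addnC leq_add //.
  exact: leq_trans (dimvS ex) dV.
by have /memY : opV x = 0 := Vx; rewrite -ZY => /memZ[y _ ->]; exists y.
Qed.

End ExactKernels.

(** * Sections of a semilinear map adapted to a flag *)

Section AdaptedSection.

Context {K : fieldType} {V W : vectType K} (f : V -> W).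
Context (f_semi : skewlinear f).
Context (b : nat -> {vspace V}) (n : nat).
Context (b0 : b 0%N = 0%VS).
Context (b_mono : forall i j, (i <= j <= n)%N -> (b i <= b j)%VS).

Let f0 : f 0 = 0. Proof. exact (skewlinear0 f_semi). Qed.

Let fB x y : f (x - y) = f x - f y.
Proof.
rewrite (skewlinearD _ _ f_semi); congr (_ + _).
by apply/eqP; rewrite -addr_eq0 -(skewlinearD _ _ f_semi) addNr f0.
Qed.

(** At each level add a complement [T] of [C + (Ker f :&: b k.+1)] in [b k.+1]: it creates no new
    kernel vector, and the lower levels keep their old witnesses. *)
Lemma adapted_complement k : (k <= n)%N -> exists C : {vspace V},
  [/\ (C <= b k)%VS, forall x, x \in C -> f x = 0 -> x = 0
    & forall m x, (m <= k)%N -> x \in b m ->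
        exists w, [/\ w \in C, w \in b m & f w = f x]].
Proof.
elim: k => [|k IH] kn.
  exists 0%VS; split=> [|x|m x]; first exact: sub0v.
    by rewrite memv0 => /eqP.
  rewrite leqn0 => /eqP-> xb; exists 0; rewrite !mem0v; split=> //.
  by move: xb; rewrite b0 memv0 => /eqP->.
have [C [Cb Cker CP]] := IH (ltnW kn).
have bk : (b k <= b k.+1)%VS by rewrite b_mono ?leqnSn.
pose N := vspace_of (fun x => f x = 0).
have memN x : x \in N <-> f x = 0.
  apply: vspace_ofP; split=> // c y z y0 z0.
  have [s sb fZ] := skewlinearZ f_semi.
  by rewrite (skewlinearD _ _ f_semi) fZ y0 z0 scaler0 addr0.
pose Y := (C + (N :&: b k.+1))%VS; pose T := (b k.+1 :\: Y)%VS.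
have Yb : (Y <= b k.+1)%VS by rewrite subv_add (subv_trans Cb bk) capvSr.
have TY x : x \in T -> x \in Y -> x = 0.
  move=> xT xY; apply/eqP; rewrite -memv0 -(capv_diff (b k.+1) Y).
  by rewrite memv_cap xT xY.
have Tb : (T <= b k.+1)%VS by exact: diffvSl.
exists (C + T)%VS; split.
- by rewrite subv_add (subv_trans Cb bk).
- move=> _ /memv_addP[x xC [y yT ->]] xy0.
  have y0 : y = 0.
    apply: TY => //; rewrite -[y](addKr x); apply: memv_add; first by rewrite rpredN.
    rewrite memv_cap (memN _).2 //=; apply: rpredD; last exact: (subvP Tb).
    exact: (subvP (subv_trans Cb bk)).
  by move: xy0; rewrite y0 addr0; exact: Cker.
move=> m x; rewrite leq_eqVlt => /predU1P[->|mk] xb; last first.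
  have [w [wC wb wx]] := CP m x mk xb.
  by exists w; split=> //; rewrite (subvP (addvSl _ _)).
have : x \in (Y + T)%VS.
  have -> : (Y + T = b k.+1)%VS.
    by rewrite addvC addv_diff; apply/addv_idPl.
  exact: xb.
move=> /memv_addP[_ /memv_addP[w wC [z zN ->]] [t tT ->]].
have /andP[/memN z0 zb] : (z \in N) && (z \in b k.+1) by rewrite -memv_cap.
exists (w + t); split.
- exact: memv_add.
- by apply: rpredD; [exact: (subvP (subv_trans Cb bk))|exact: (subvP Tb)].
by rewrite !(skewlinearD _ _ f_semi) z0 addr0.
Qed.

(** Project onto the image [I] and invert [f] on the adapted complement. For [x] in [b m], the
    unique preimage of [f x] there is already in [b m]. *)
Lemma adapted_section (I : {vspace W}) : b n = fullv ->
  (forall y, y \in I <-> exists x, y = f x) ->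
  exists g : W -> V, [/\ skewlinear g, forall y, y \in I -> f (g y) = y
    & forall m x, (m <= n)%N -> x \in b m -> g (f x) \in b m].
Proof.
move=> bn IP; have [C [_ Cker CP]] := adapted_complement (leqnn n).
have Cinj x y : x \in C -> y \in C -> f x = f y -> x = y.
  move=> xC yC fxy; apply/eqP; rewrite -subr_eq0; apply/eqP/Cker; first exact: rpredB.
  by rewrite fB fxy subrr.
have ex y : exists2 w, w \in C & f w = projv I y.
  have /IP[x ->] := memv_proj I y.
  have [|w [wC _ wx]] := CP n x (leqnn n); first by rewrite bn memvf.
  by exists w.
pose g y := s2val (cid2 (ex y)).
have gC y : g y \in C by rewrite /g; case: cid2.
have fg y : f (g y) = projv I y by rewrite /g; case: cid2.
exists g; split.
- have [s [t sK tK] fZ] := skewlinearZ f_semi.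
  exists t => [|c x y]; first by exists s.
  apply: Cinj; rewrite ?rpredD ?rpredZ //.
  by rewrite fg (skewlinearD _ _ f_semi) fZ !fg linearP tK.
- by move=> y yI; rewrite fg projv_id.
move=> m x mn xb; have [w [wC wb wx]] := CP m x mn xb.
suff -> : g (f x) = w by [].
by apply: Cinj => //; rewrite fg wx projv_id //; apply/IP; exists x.
Qed.

End AdaptedSection.

Section Cycles.

Context {K : fieldType} {sigma tau : {rmorphism K -> K}}.
Context {M : twisted_module sigma tau}.

Definition bijects (f : M -> M) (X Y : {vspace M}) : Prop :=
  [/\ forall x, x \in X -> f x \in Y, forall x, x \in X -> f x = 0 -> x = 0
    & forall y, y \in Y -> exists2 x, x \in X & y = f x].

(** The bridge from the flag to circular quivers; [S] may still have several cycles. *)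
Variant cyclic_decomposition n (S : 'I_n -> 'I_n) (l : 'I_n -> letter)
    (U : 'I_n -> {vspace M}) : Prop :=
  CyclicDecomposition of
    injective S
  & (forall i j, (forall k, l (iter k S i) = l (iter k S j)) -> i = j)
  & (forall i, U i != 0%VS)
  & (forall u : 'I_n -> M, (forall i, u i \in U i) -> \sum_i u i = 0 -> forall i, u i = 0)
  & (forall y, exists2 u : 'I_n -> M, forall i, u i \in U i & y = \sum_i u i)
  & (forall i, l i = WF ->
       bijects opF (U i) (U (S i)) /\ forall y, y \in U (S i) -> opV y = 0)
  & (forall i, l i = WVs ->
       bijects opV (U (S i)) (U i) /\ forall x, x \in U i -> opF x = 0).

End Cycles.

(** * The shift on the steps of the canonical flag, and its Fitting decomposition *)

Section CanonicalFlag.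

Context {K : fieldType} {sigma tau : {rmorphism K -> K}}.
Context (sigma_bij : bijective sigma) (tau_bij : bijective tau).
Context {M : twisted_module sigma tau}.
Context (exact_F : (kerF <= (imV : {vspace M}))%VS).
Context (b : nat -> {vspace M}) (n : nat).
Context (b0 : b 0%N = 0%VS) (bn : b n = fullv).
Context (b_lt : forall i j, (i < j <= n)%N -> (b i <= b j)%VS && (b i != b j)).
Context (bP : forall Z, in_chain Z <-> exists2 k, (k <= n)%N & Z = b k).

Let exact_V (x : M) : opV x = 0 -> exists y, x = opF y.
Proof. exact: exact_kerV. Qed.

Lemma flag_mono i j : (i <= j <= n)%N -> (b i <= b j)%VS.
Proof.
move=> /andP[]; rewrite leq_eqVlt => /predU1P[-> _|ij jn]; first exact: subvv.
by have /andP[] := b_lt (introT andP (conj ij jn)).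
Qed.

Lemma flag_le i j : (i <= n)%N -> (j <= n)%N -> (b i <= b j)%VS = (i <= j)%N.
Proof.
move=> iN jN; case: (leqP i j) => [ij|ji]; first by apply: flag_mono; rewrite ij.
have /andP[le ne] := b_lt (introT andP (conj ji iN)).
by apply: contraNF ne => le'; rewrite eqEsubv le.
Qed.

Lemma flag_act a k : (k <= n)%N -> exists2 m, (m <= n)%N & act a (b k) = b m.
Proof. by move=> kn; apply/bP/chain_act/bP; exists k. Qed.

Lemma imV_index : exists2 q, (q <= n)%N & (imV : {vspace M}) = b q.
Proof. by exact/bP/chain_act/chain1. Qed.

Definition q_ind := s2val (cid2 imV_index).
Let q := q_ind.
Let qn : (q <= n)%N. Proof. by rewrite /q /q_ind; case: cid2. Qed.
Let imVq : (imV : {vspace M}) = b q. Proof. by rewrite /q /q_ind; case: cid2. Qed.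
Let kerFq : (kerF : {vspace M}) = b q.
Proof. by rewrite -imVq; apply/eqP; rewrite eqEsubv exact_F imV_kerF. Qed.

(** [V M = Ker F] cuts the flag in two: [WVs] takes values below it and [WF] above it. The index [q]
    counts on both sides. *)
Let side a k := if a is WVs then (k <= q)%N else (q <= k)%N.

Lemma act_side a k m : (k <= n)%N -> (m <= n)%N -> act a (b k) = b m -> side a m.
Proof.
move=> kn mn; case: a => e /=; rewrite -flag_le // -e.
  by rewrite -kerFq; apply: act_mono => //; exact: sub0v.
by rewrite -imVq; apply: act_mono => //; exact: subvf.
Qed.

(** [b q] is both [V M] and [Ker F]. Any other image under a letter has its letter fixed by its
    side, while 0 is [V 0] and [M] is the preimage of [M] under [F]. *)
Lemma act_onto a k : (k <= n)%N -> side a k -> exists2 m, (m <= n)%N & b k = act a (b m).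
Proof.
move=> kn sk.
have [kq|kq] := eqVneq k q.
  rewrite kq; case: a {sk}; first by exists 0%N; rewrite // b0 -kerFq.
  by exists n; rewrite // bn -imVq.
have ck : in_chain (b k) by apply/bP; exists k.
case: (chain_act_inv ck) => [k0|[k1|[a' [Z [/bP[m mn ->] e]]]]].
- case: a sk => /= sk.
    by case/negP: kq; rewrite eqn_leq sk -flag_le // k0 sub0v.
  exists 0%N => //; apply/vspaceP => x; rewrite k0 b0.
  apply/idP/idP => [|/(mem_actV tau_bij)[y]]; rewrite !memv0.
    by move/eqP->; apply/(mem_actV tau_bij); exists 0; rewrite ?mem0v ?linear0.
  by move=> /eqP-> ->; rewrite linear0.
- case: a sk => /= sk; last by case/negP: kq; rewrite eqn_leq sk -flag_le // k1 subvf.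
  exists n => //; apply/vspaceP => x; rewrite k1 bn memvf; apply/esym.
  by apply/mem_actF; rewrite memvf.
have sk' := act_side mn kn (esym e).
suff aa : a' = a by exists m; rewrite // -aa.
move: sk sk'; case: a a' {e} => [] [] //= s1 s2; case/negP: kq; rewrite eqn_leq ?s1 ?s2 //.
Qed.

Definition flag_letter (i : 'I_n) := if (i < q)%N then WVs else WF.
Local Notation lt := flag_letter.

Lemma flag_letter_side i : side (lt i) i && side (lt i) i.+1.
Proof. by rewrite /flag_letter /side; case: ltnP => h; rewrite ?h ?(ltnW h) ?(leqW h). Qed.

(** Let [j.+1] be the least index whose image is [b i.+1]. By monotonicity the image of [b j] lies
    between [b i] and [b i.+1], and minimality excludes the latter. *)
Lemma shift_ex (i : 'I_n) : exists j : 'I_n,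
  b i = act (lt i) (b j) /\ b i.+1 = act (lt i) (b j.+1).
Proof.
have /andP[s0 s1] := flag_letter_side i; set a := lt i in s0 s1 *.
have iN := ltn_ord i.
have ex1 : exists k, (k <= n)%N && (b i.+1 == act a (b k)).
  by have [k kn e] := act_onto iN s1; exists k; rewrite kn -e eqxx.
have [k' k'n e'] := act_onto (ltnW iN) s0.
case: (ex_minnP ex1) => k /andP[kn /eqP e] kmin.
have k'k : (k' < k)%N.
  rewrite ltnNge; apply/negP => kk'.
  have : (b i.+1 <= b i)%VS by rewrite e e' act_mono // flag_mono // kk' k'n.
  by rewrite flag_le ?ltnn // ltnW.
case: k k'k e kn kmin => // j k'j e jn kmin.
exists (Ordinal jn); split=> //=.
have [m mn em] := flag_act a (ltnW jn).
have mi : (m <= i.+1)%N by rewrite -flag_le // -em e act_mono // flag_mono ?leqnSn.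
have im : (i <= m)%N by rewrite -flag_le ?(ltnW iN) // -em e' act_mono // flag_mono //
    -ltnS k'j ltnW.
rewrite em; congr b; apply/eqP; rewrite eqn_leq im; move: mi.
rewrite leq_eqVlt => /predU1P[mi|//].
have := kmin j; rewrite (ltnW jn) em mi eqxx => /(_ isT); by rewrite ltnn.
Qed.

Definition shift (i : 'I_n) : 'I_n := sval (cid (shift_ex i)).
Local Notation S := shift.

Lemma shiftP (i : 'I_n) : b i = act (lt i) (b (S i)) /\ b i.+1 = act (lt i) (b (S i).+1).
Proof. by rewrite /shift; case: cid. Qed.

(** The step just above the image of [b j] shifts to [j], by monotonicity. *)
Lemma shift_onto a (j : 'I_n) : act a (b j) != act a (b j.+1) ->
  exists2 i, S i = j & lt i = a.
Proof.
move=> ne; have jn := ltn_ord j.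
have [k kn ek] := flag_act a (ltnW jn); have [m mn em] := flag_act a jn.
have km : (k < m)%N.
  rewrite ltn_neqAle; apply/andP; split; first by apply: contra_neq ne => e; rewrite ek em e.
  by rewrite -flag_le // -ek -em act_mono // flag_mono // leqnSn.
have kN : (k < n)%N := leq_trans km mn.
exists (Ordinal kN); last first.
  have := act_side (ltnW jn) kn ek; have := act_side jn mn em.
  rewrite /flag_letter /side; case: (a) => /=; last by move=> h _; rewrite (leq_trans km h).
  by move=> _; rewrite leqNgt => /negPf->.
set i := Ordinal kN; have lti : lt i = a.
  have := act_side (ltnW jn) kn ek; have := act_side jn mn em.
  rewrite /flag_letter /side; case: (a) => /=; last by move=> h _; rewrite (leq_trans km h).
  by move=> _; rewrite leqNgt => /negPf->.
have [e1 e2] := shiftP i; rewrite lti in e1 e2.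
apply/val_inj/eqP; rewrite eqn_leq; apply/andP; split; rewrite leqNgt; apply/negP => h.
  have : (b m <= b i)%VS by rewrite -em e1 act_mono // flag_mono // h ltnW.
  by rewrite flag_le ?(ltnW kN) //= leqNgt km.
have : (b i.+1 <= b k)%VS by rewrite -ek e2 act_mono // flag_mono // h ltnW.
by rewrite flag_le //= ltnn.
Qed.

(** If [V] loses the step, any [x] in [b j.+1] is [y + F z] with [y] in [b j], as [Ker V = F M]. If
    preimages under [F] lose it too, [F z] is in [b j]. *)
Lemma act_both (j : 'I_n) : act WVs (b j) = act WVs (b j.+1) ->
  act WF (b j) = act WF (b j.+1) -> False.
Proof.
move=> eV eF; suff : (b j.+1 <= b j)%VS by rewrite flag_le ?ltnn // ltnW.
apply/subvP => x xb.
have : opV x \in act WVs (b j) by rewrite eV; apply/(mem_actV tau_bij); exists x.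
move=> /(mem_actV tau_bij)[y yb xy].
have [z xyz] : exists z, x - y = opF z by apply: exact_V; rewrite linearB xy subrr.
have : z \in act WF (b j).
  rewrite eF; apply/mem_actF; rewrite -xyz rpredB //.
  by apply: (subvP (flag_mono _)) yb; rewrite leqnSn ltn_ord.
by move=> /mem_actF zb; rewrite -[x](subrK y) rpredD // xyz.
Qed.

(** Every step survives under some letter, so the shift is onto the finite set of steps. *)
Lemma shift_inj : injective S.
Proof.
have ex (j : 'I_n) : exists i, S i = j.
  have [eV|/shift_onto[i <- _]] := eqVneq (act WVs (b j)) (act WVs (b j.+1)); last by exists i.
  have [eF|/shift_onto[i <- _]] := eqVneq (act WF (b j)) (act WF (b j.+1)); last by exists i.
  by case: (act_both eV eF).
pose h j := sval (cid (ex j)).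
have hK : cancel h S by move=> j; rewrite /h; case: cid.
have [h' hK' h'K] := injF_bij (can_inj hK).
have Sh : S =1 h' by move=> x; rewrite -{1}(h'K x) hK.
by move=> x y; rewrite !Sh => /(can_inj h'K).
Qed.

Lemma shift_mono (i j : 'I_n) : lt i = lt j -> (i < j)%N -> (S i < S j)%N.
Proof.
move=> ll ij; rewrite ltnNge; apply/negP => ji.
have : (b j <= b i)%VS.
  by rewrite (shiftP i).1 (shiftP j).1 ll act_mono // flag_mono // ji ltnW.
by rewrite flag_le ?(ltnW (ltn_ord _)) // leqNgt ij.
Qed.

(** By injectivity, [S i] is reached through the letter of [i] only, so the other letter must
    collapse it. *)
Lemma shift_other a (i : 'I_n) : lt i != a -> act a (b (S i)) = act a (b (S i).+1).
Proof.
move=> la; apply/eqP/negPn/negP => /shift_onto[i' /shift_inj -> e].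
by rewrite e eqxx in la.
Qed.

(** Induction on a chain member [Z] between the two steps. If both have the same letter, it is the
    first letter of [Z]; removing it leaves a member between the shifted steps, until 0 or [M],
    which separate nothing. *)
Lemma letters_separate (i j : 'I_n) : (forall k, lt (iter k S i) = lt (iter k S j)) -> i = j.
Proof.
suff H Z : in_chain Z -> forall i j : 'I_n, (b i.+1 <= Z)%VS -> (Z <= b j)%VS ->
    ~ forall k, lt (iter k S i) = lt (iter k S j).
  have H' (i' j' : 'I_n) : (i' < j')%N -> ~ forall k, lt (iter k S i') = lt (iter k S j').
    move=> ij; apply: (H (b j')); rewrite ?subvv //.
      by apply/bP; exists j'; rewrite // ltnW.
    by apply: flag_mono; rewrite ij ltnW.
  move=> e; apply/val_inj; case: (ltngtP i j) => // ij; first by case: (H' _ _ ij).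
  by case: (H' _ _ ij) => k.
move: Z; apply: chain_ind => {i j} [i j|i j|a Z cZ IH i j] bZ Zb lij.
- by move: bZ; rewrite -b0 flag_le.
- by move: Zb; rewrite -bn flag_le ?(ltnW (ltn_ord _)) // leqNgt ltn_ord.
have [m mn Zm] := (bP Z).1 cZ; rewrite Zm in bZ Zb.
have [k kn ek] := flag_act a mn; rewrite ek in bZ Zb.
have sk := act_side mn kn ek.
move: (bZ) (Zb); rewrite !flag_le ?(ltnW (ltn_ord _)) // => ik kj.
have l0 : lt i = lt j := lij 0%N.
have [li lj] : lt i = a /\ lt j = a.
  suff h : lt i = a \/ lt j = a by case: h l0 => -> h; split=> //; rewrite h.
  move: sk; rewrite /flag_letter /side; case: (a) => sk; last by left; rewrite (leq_trans ik sk).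
  by right; rewrite ltnNge (leq_trans sk kj).
apply: (IH (S i) (S j)); rewrite ?Zm.
- rewrite flag_le // ltnNge; apply/negP => mi.
  have : (b i.+1 <= b i)%VS.
    rewrite (subv_trans bZ) // -ek [X in (_ <= X)%VS](shiftP i).1 li act_mono //.
    by rewrite flag_mono // mi ltnW.
  by rewrite flag_le ?ltnn // ltnW.
- rewrite flag_le ?(ltnW (ltn_ord _)) // leqNgt; apply/negP => mj.
  have : (b j.+1 <= b j)%VS.
    rewrite (subv_trans _ Zb) // -ek (shiftP j).2 lj act_mono //.
    by rewrite flag_mono // mj.
  by rewrite flag_le ?ltnn // ltnW.
by move=> k'; have := lij k'.+1; rewrite !iterSr.
Qed.

(* A section of V preserving the flag, so that walking to the right becomes a  *)
(* function which is nilpotent below each step of the flag.                   *)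
Lemma section_ex : exists g : M -> M, [/\ skewlinear g,
    forall y, y \in (imV : {vspace M}) -> opV (g y) = y
  & forall m x, (m <= n)%N -> x \in b m -> g (opV x) \in b m].
Proof.
apply: (adapted_section (opV_skewlinear tau_bij) b0 flag_mono bn).
exact: mem_imV.
Qed.

Let g := sval (cid section_ex).
Let g_skew : skewlinear g. Proof. by rewrite /g; case: cid => ? []. Qed.
Let gK y : y \in (imV : {vspace M}) -> opV (g y) = y.
Proof. by rewrite /g; case: cid => /= h [_ hK _]; exact: hK. Qed.
Let g_flag m x : (m <= n)%N -> x \in b m -> g (opV x) \in b m.
Proof. by rewrite /g; case: cid => /= h [_ _ h_flag]; exact: h_flag. Qed.

Let step a : M -> M := if a is WVs then g else opF.

Let step_skew a : skewlinear (step a).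
Proof. by case: a => /=; [exact: opF_skewlinear|exact: g_skew]. Qed.

Let step0 a : step a 0 = 0. Proof. exact: skewlinear0 (step_skew a). Qed.

Let letterV (i : 'I_n) : lt i = WVs -> (b i.+1 <= imV)%VS.
Proof.
rewrite /flag_letter; case: ltnP => // iq _.
by rewrite imVq flag_mono // iq.
Qed.

Let bS (i : 'I_n) : (b i <= b i.+1)%VS.
Proof. by rewrite flag_mono // leqnSn ltn_ord. Qed.

Lemma step_act (i : 'I_n) m x : (m <= n)%N ->
  x \in act (lt i) (b m) -> step (lt i) x \in b m.
Proof.
move=> mn; case: (lt i) => [/mem_actF//|/(mem_actV tau_bij)[y ym ->]].
exact: g_flag.
Qed.

Lemma step_top (i : 'I_n) x : x \in b i.+1 -> step (lt i) x \in b (S i).+1.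
Proof. by rewrite (shiftP i).2; apply: step_act. Qed.

Lemma step_bot (i : 'I_n) x : x \in b i -> step (lt i) x \in b (S i).
Proof. by rewrite (shiftP i).1; apply: step_act; rewrite ltnW. Qed.

Lemma step_inj (i : 'I_n) x : x \in b i.+1 -> step (lt i) x \in b (S i) -> x \in b i.
Proof.
move=> xb; rewrite [in x \in _](shiftP i).1; case li: (lt i) => /= sx.
  exact/mem_actF.
apply/(mem_actV tau_bij); exists (g x) => //.
by rewrite gK // (subvP (letterV li)).
Qed.

(** With [step_inj], this makes a letter an isomorphism between quotients of the flag. For [WF], the
    collapse under [V] corrects [y] modulo [b (S i)] into [Ker V = F M]. For [WVs], [y - g (opV y)]
    is in [Ker V = F M], and the collapse under [WF] puts it in [b (S i)]. *)
Lemma step_onto (i : 'I_n) y : y \in b (S i).+1 ->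
  exists2 x, x \in b i.+1 & y - step (lt i) x \in b (S i).
Proof.
move=> yb; case li: (lt i) => /=.
  have : opV y \in act WVs (b (S i)).
    by rewrite shift_other ?li //; apply/(mem_actV tau_bij); exists y.
  move=> /(mem_actV tau_bij)[z zb Vyz].
  have [x yzx] : exists x, y - z = opF x by apply: exact_V; rewrite linearB Vyz subrr.
  exists x; last by rewrite -yzx subKr.
  rewrite (shiftP i).2 li; apply/mem_actF; rewrite -yzx rpredB //.
  exact: (subvP (bS _)).
have Vb : opV y \in b i.+1.
  by rewrite (shiftP i).2 li; apply/(mem_actV tau_bij); exists y.
exists (opV y) => //; set z := y - _.
have zb : z \in b (S i).+1 by rewrite rpredB // g_flag.
have [x zx] : exists x, z = opF x.
  apply: exact_V; rewrite linearB gK ?subrr //.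
  by apply/(mem_imV tau_bij); exists y.
have : x \in act WF (b (S i)) by rewrite shift_other ?li //; apply/mem_actF; rewrite -zx.
by rewrite zx => /mem_actF.
Qed.

Fixpoint steps k (i : 'I_n) (x : M) : M :=
  if k is k'.+1 then steps k' (S i) (step (lt i) x) else x.

Lemma stepsSr k i x : steps k.+1 i x = step (lt (iter k S i)) (steps k i x).
Proof. by elim: k i x => // k IH i x; rewrite [LHS]IH -iterSr. Qed.

Lemma steps_skew k i : skewlinear (steps k i).
Proof.
elim: k i => [|k IH] i; first by exists id => //; exists id.
exact: (skewlinear_comp (step_skew (lt i)) (IH (S i))).
Qed.

Lemma steps_top k (i : 'I_n) x : x \in b i.+1 -> steps k i x \in b (iter k S i).+1.
Proof. by elim: k => // k IH xb; rewrite stepsSr iterS step_top // IH. Qed.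

Lemma steps_inj k (i : 'I_n) x :
  x \in b i.+1 -> steps k i x \in b (iter k S i) -> x \in b i.
Proof.
elim: k => // k IH xb; rewrite stepsSr iterS => /step_inj h; apply: IH => //.
exact/h/steps_top.
Qed.

Lemma steps_bot k (i : 'I_n) x : x \in b i -> steps k i x \in b (iter k S i).
Proof. by elim: k => // k IH xb; rewrite stepsSr iterS step_bot // IH. Qed.

Lemma steps_onto k (i : 'I_n) y : y \in b (iter k S i).+1 ->
  exists2 x, x \in b i.+1 & y - steps k i x \in b (iter k S i).
Proof.
elim: k i => [|k IH] i yb; first by exists y; rewrite ?subrr ?mem0v.
rewrite iterSr in yb *; have [x' x'b yx'] := IH _ yb.
have [x xb x'x] := step_onto x'b; exists x => //=.
have -> : y - steps k (S i) (step (lt i) x) =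
    (y - steps k (S i) x') + steps k (S i) (x' - step (lt i) x).
  rewrite -{1}(subrK (step (lt i) x) x') (skewlinearD _ _ (steps_skew _ _)).
  by rewrite [steps _ _ (_ - _) + _]addrC opprD addrA subrK.
by rewrite rpredD // steps_bot.
Qed.

(** Compare with [j], the step just below. Until the words of [i] and [j] differ, both walks agree
    and the shifts keep their order, so at the first difference [j] reads [WVs] and [i] reads [WF].
    The vector has then reached [V M = Ker F], and [F] kills it. *)
Lemma steps_nilpotent_at (i : 'I_n) : exists k, forall x, x \in b i -> steps k i x = 0.
Proof.
case i0 : (nat_of_ord i) => [|m].
  by exists 0%N => x; rewrite b0 memv0 => /eqP.
have mn : (m < n)%N by rewrite ltnW // -i0.
pose j := Ordinal mn; have ji : (j < i)%N by rewrite i0.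
have [k lk kmin] : exists2 k, lt (iter k S j) != lt (iter k S i) &
    forall k', (k' < k)%N -> lt (iter k' S j) = lt (iter k' S i).
  have ex : exists k, lt (iter k S j) != lt (iter k S i).
    apply: contrapT => no; have : j = i.
      apply: letters_separate => k; apply/eqP/negPn/negP => h; by apply: no; exists k.
    by move=> e; move: ji; rewrite e ltnn.
  case: (ex_minnP ex) => k lk kmin; exists k => // k' k'k.
  by apply/eqP/negPn/negP => /kmin; rewrite leqNgt k'k.
have agree k' x : (k' <= k)%N -> steps k' j x = steps k' i x /\
    (iter k' S j < iter k' S i)%N.
  elim: k' => [//|k' IH] k'k; have [e h] := IH (ltnW k'k).
  rewrite !stepsSr e kmin //; split=> //; rewrite !iterS.
  by apply: shift_mono => //; rewrite kmin.
exists k.+1 => x xb; have [e h] := agree k x (leqnn k).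
have xj : x \in b j.+1 by [].
have [lj li] : lt (iter k S j) = WVs /\ lt (iter k S i) = WF.
  move: lk h; rewrite /flag_letter; case: (ltnP (iter k S j)) => jq;
    case: (ltnP (iter k S i)) => iq //= _ h.
  by move: (leq_ltn_trans jq (ltn_trans h iq)); rewrite ltnn.
rewrite stepsSr -e li; apply/mem_kerF.
exact: (subvP (subv_trans (letterV lj) (imV_kerF tau_bij))) (steps_top k xj).
Qed.

Lemma steps_period : exists L, (forall i, iter L S i = i) /\
  forall (i : 'I_n) x, x \in b i -> steps L i x = 0.
Proof.
pose k i := sval (cid (steps_nilpotent_at i)).
have kP (i : 'I_n) x : x \in b i -> steps (k i) i x = 0.
  exact: (svalP (cid (steps_nilpotent_at i)) x).
have stay d m i x : steps m i x = 0 -> steps (d + m) i x = 0.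
  by move=> h; elim: d => [//|d IH]; rewrite addSn stepsSr IH step0.
have so i : iter n`! S i = i.
  have /dvdnP[c ->] : (order S i %| n`!)%N.
    by rewrite dvdn_fact // order_gt0 /= -[leqRHS]card_ord max_card.
  by elim: c => // c IH; rewrite mulSn iterD IH iter_order //; exact: shift_inj.
(* A common multiple of the orbit lengths, at least as large as every nilpotency bound. *)
exists (n`! * \max_i k i)%N; split=> [i|i x xb].
  by elim: (\max_i k i) => [|m IH]; rewrite ?muln0 // mulnS iterD IH so.
have le : (k i <= n`! * \max_i k i)%N.
  by rewrite (leq_trans (leq_bigmax i)) // leq_pmull // fact_gt0.
by rewrite -(subnK le); apply: stay; exact: kP.
Qed.

(** Fitting: [L] steps return to the step [i], kill [b i] and act bijectively on the quotient, so
    the image [U i] of [b i.+1] is a complement of [b i] in it. Walking one step commutes with this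
    construction. *)
Lemma flag_cyclic_decomposition : exists (l : 'I_n -> letter) (U : 'I_n -> {vspace M}),
  cyclic_decomposition S l U.
Proof.
have [L [SL Lb]] := steps_period.
pose U (i : 'I_n) := vspace_of (fun y => exists2 x, x \in b i.+1 & y = steps L i x).
have memU i y : y \in U i <-> exists2 x, x \in b i.+1 & y = steps L i x.
  exact: vspace_ofP (skewlinear_image _ (steps_skew L i)).
have Ub (i : 'I_n) : (U i <= b i.+1)%VS.
  by apply/subvP => _ /memU[x xb ->]; rewrite -[in b _](SL i) steps_top.
have U0 (i : 'I_n) y : y \in U i -> y \in b i -> y = 0.
  by move=> /memU[x xb ->]; rewrite -[in b _](SL i) => /(steps_inj xb)/Lb.
have UD (i : 'I_n) y : y \in b i.+1 -> exists2 u, u \in U i & y - u \in b i.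
  move=> yb; have [|x xb] := @steps_onto L i y; rewrite SL // => yx.
  by exists (steps L i x) => //; apply/memU; exists x.
have stepU (i : 'I_n) : bijects (step (lt i)) (U i) (U (S i)).
  split.
  - move=> _ /memU[x xb ->]; apply/memU; exists (step (lt i) x); first exact: step_top.
    by rewrite -[RHS]/(steps L.+1 i x) stepsSr SL.
  - move=> x xU x0; apply: (U0 i) => //; apply: step_inj; first exact: (subvP (Ub i)).
    by rewrite x0 mem0v.
  move=> _ /memU[y yb ->]; have [x xb yx] := step_onto yb.
  exists (steps L i x); first by apply/memU; exists x.
  have -> : step (lt i) (steps L i x) = steps L (S i) (step (lt i) x).
    by rewrite -[RHS]/(steps L.+1 i x) stepsSr SL.
  rewrite -[y in LHS](subrK (step (lt i) x)).
  by rewrite (skewlinearD _ _ (steps_skew _ _)) Lb // add0r.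
have below (u : 'I_n -> M) (j : 'I_n) : (forall i, u i \in U i) ->
    (forall i : 'I_n, (j < i)%N -> u i = 0) -> \sum_(i | i != j) u i \in b j.
  move=> uU uj; apply: rpred_sum => i ij; case: (ltngtP i j) => [lij|lji|e].
  - by apply: (subvP (subv_trans (Ub i) (flag_mono _))); rewrite // lij ltnW.
  - by rewrite uj // mem0v.
  by case/eqP: ij; apply/val_inj.
exists lt, U; split.
- exact: shift_inj.
- exact: letters_separate.
- move=> i; apply/eqP => Ui0.
  have : (b i.+1 <= b i)%VS; last by rewrite flag_le ?ltnn // ltnW.
  apply/subvP => y /UD[u]; rewrite Ui0 memv0 => /eqP->.
  by rewrite subr0.
- move=> u uU u0 i; apply/eqP/negPn/negP => ui.
  (* With [j] the largest index of a non-zero term, the relation puts [u j] in [b j], which meets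
     [U j] in 0 only. *)
  pose j := [arg max_(j > i | u j != 0) (j : nat)].
  have [uj jmax] : u j != 0 /\ forall k, u k != 0 -> (k <= j)%N.
    by rewrite /j; case: arg_maxnP.
  have high (k : 'I_n) : (j < k)%N -> u k = 0.
    by move=> jk; apply/eqP/negPn/negP => /jmax; rewrite leqNgt jk.
  case/negP: uj; apply/eqP/(U0 j) => //.
  move: u0; rewrite (bigD1 j) //= => /eqP; rewrite addr_eq0 => /eqP->.
  by rewrite rpredN below.
- suff H k y : (k <= n)%N -> y \in b k ->
      exists2 u : 'I_n -> M, forall i, u i \in U i & y = \sum_i u i.
    by move=> y; apply: (H n) => //; rewrite bn memvf.
  elim: k y => [|k IH] y kn yb.
    exists (fun=> 0) => [i|]; first exact: mem0v.
    by move: yb; rewrite b0 memv0 => /eqP->; rewrite big1.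
  have [v vU yv] := UD (Ordinal kn) y yb; have [u uU e] := IH _ (ltnW kn) yv.
  exists (fun i => u i + (if i == Ordinal kn then v else 0)) => [i|].
    by rewrite rpredD //; case: eqP => [->//|_]; exact: mem0v.
  by rewrite big_split /= -e -big_mkcond big_pred1_eq subrK.
- move=> i li; have := stepU i; rewrite li => sU; split=> // y.
  by case: sU => _ _ h /h[x _ ->]; rewrite /= opVF0.
move=> i li; have := stepU i; rewrite li /= => -[s1 s2 s3].
have iV x : x \in U i -> x \in (imV : {vspace M}).
  by move=> /(subvP (Ub i)); apply/subvP/letterV.
split; last first.
  by move=> x /iV xV; apply/mem_kerF; apply: (subvP (imV_kerF tau_bij)).
split.
- by move=> _ /s3[x xU ->]; rewrite gK // iV.
- by move=> _ /s3[x xU ->]; rewrite gK ?iV // => ->; exact: (skewlinear0 g_skew).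
by move=> x xU; exists (g x); [exact: s1|rewrite gK // iV].
Qed.

End CanonicalFlag.

Section BandExistence.

Context {K : fieldType} {sigma tau : {rmorphism K -> K}}.
Context (sigma_bij : bijective sigma) (tau_bij : bijective tau).
Context {M : twisted_module sigma tau}.

Lemma cyclic_decomposition_ex : (kerF <= (imV : {vspace M}))%VS ->
  exists n (S : 'I_n -> 'I_n) l (U : 'I_n -> {vspace M}), cyclic_decomposition S l U.
Proof.
move=> ex; have [beta [[h0 h1 sorted_beta _ _] bP]] := stabilized_ex tau_bij (M := M).
pose n := (size beta).-1; pose b k := nth 0%VS beta k.
have sb : size beta = n.+1.
  rewrite prednK // lt0n size_eq0; apply/eqP => b0.
  by have /bP := chain0 (M := M); rewrite b0.
have b0 : b 0%N = 0%VS by move: h0 sb; rewrite /b; case: (beta).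
have bn : b n = fullv by rewrite /b nth_last.
have blt i j : (i < j <= n)%N -> (b i <= b j)%VS && (b i != b j).
  move=> /andP[ij jn]; apply: (sorted_ltn_nth strict_subv_trans) => //; rewrite inE sb //.
  by rewrite ltnS (leq_trans (ltnW ij)).
have bP' Z : in_chain Z <-> exists2 k, (k <= n)%N & Z = b k.
  rewrite -bP; split=> [/(nthP 0%VS)[k kb <-]|[k kn ->]]; last by rewrite mem_nth ?sb.
  by exists k; rewrite // -ltnS -sb.
have [l [U D]] := flag_cyclic_decomposition sigma_bij tau_bij ex b0 bn blt bP'.
by exists n; eexists; exists l, U; exact: D.
Qed.

End BandExistence.

Lemma inj_onto_bijective (A B : Type) (f : A -> B) :
  injective f -> (forall y, exists x, f x = y) -> bijective f.
Proof.
move=> inj onto; exists (fun y => sval (cid (onto y))) => [x|y]; last by case: cid.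
by apply: inj; case: cid.
Qed.

Lemma iter_ordS m k (i : 'I_m) : iter k (@ordS m) i = ((i + k) %% m)%N :> nat.
Proof.
elim: k => [|k IH]; first by rewrite addn0 modn_small.
by rewrite iterS /= IH -addn1 modnDml addn1 addnS.
Qed.

Lemma cyclic_decomposition_inj (K : fieldType) (sigma tau : {rmorphism K -> K})
    (M : twisted_module sigma tau) n (S : 'I_n -> 'I_n) l (U : 'I_n -> {vspace M}) :
  cyclic_decomposition S l U -> injective S.
Proof. by case. Qed.

(** * The circular quiver of a cyclic decomposition *)

Section BandModule.

Context {K : fieldType} {sigma tau : {rmorphism K -> K}}.
Context {M : twisted_module sigma tau} (M_indec : indecomposable_module M).
Context {n : nat} {S : 'I_n -> 'I_n} {l : 'I_n -> letter} {U : 'I_n -> {vspace M}}.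
Context (D : cyclic_decomposition S l U).

Let S_inj := cyclic_decomposition_inj D.
Let G := quiver [set: 'I_n] l S_inj.

Lemma op_additive a (x y : M) : op a (x - y) = op a x - op a y.
Proof. exact: linearB. Qed.

Let opU (e : arrow G) x : x \in U (tail_of (val e)) ->
  op (label_of (val e)) x \in U (head_of (val e)).
Proof.
case: D => _ _ _ _ _ DF DV; case: e => -[[i j] []] /= eG; rewrite /tail_of /head_of /=.
  by move: eG; rewrite quiver_arrowF => /and3P[_ /eqP/DF[[h _ _] _] /eqP->] /h.
by move: eG; rewrite quiver_arrowV => /and3P[_ /eqP/DV[[h _ _] _] /eqP->] /h.
Qed.

Definition band_map (e : arrow G) (u : subvs_of (U (tail_of (val e)))) :
    subvs_of (U (head_of (val e))) :=
  vsproj _ (op (label_of (val e)) (vsval u)).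

Fact band_map_linear e :
  linear_for (twist sigma tau (label_of (val e)) \; *:%R) (@band_map e).
Proof. by move=> a u v; rewrite /band_map !linearP. Qed.

HB.instance Definition _ e := GRing.isLinear.Build K _ _ _ (@band_map e) (@band_map_linear e).

Definition band_rep : representation sigma tau G :=
  @Representation K sigma tau G (fun i => subvs_of (U i)) (fun e => @band_map e).

Lemma band_mapE e u : vsval (@band_map e u) = op (label_of (val e)) (vsval u).
Proof. by rewrite vsprojK // opU // subvsP. Qed.

Lemma band_strict : strict_rep band_rep.
Proof.
move=> e;
  have [_ h1 h2] : bijects (op (label_of (val e))) (U (tail_of (val e))) (U (head_of (val e))).
  case: D => _ _ _ _ _ DF DV; case: e => -[[i j] []] /= eG; rewrite /tail_of /head_of /=.
    by move: eG; rewrite quiver_arrowF => /and3P[_ /eqP/DF[h _] /eqP->].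
  by move: eG; rewrite quiver_arrowV => /and3P[_ /eqP/DV[h _] /eqP->].
apply: inj_onto_bijective => [u v uv|y].
  apply/val_inj/eqP; rewrite -subr_eq0; apply/eqP/h1; first by rewrite rpredB ?subvsP.
  by rewrite op_additive -!band_mapE [X in vsval X - _]uv subrr.
have [x xU yx] := h2 _ (subvsP y); exists (vsproj _ x).
by apply/val_inj; rewrite [LHS]band_mapE vsprojK.
Qed.

Lemma band_module_iso : isomorphic_modules M (kraft_module band_rep).
Proof.
case: D => _ _ _ inj onto DF DV.
apply: (@kraft_module_iso _ _ _ G band_rep M (fun i => vsval)).
- by move=> e u; exact/esym/band_mapE.
- move=> [] i u nw /=.
    have [li|li] : l i = WF \/ l i = WVs by case: (l i); auto.
      by have := nw (S i); rewrite quiver_arrowF inE li !eqxx.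
    by have [_] := DV _ li; apply; exact: subvsP.
  have [h hK Kh] := injF_bij S_inj; rewrite -(Kh i) in u nw *.
  have [li|li] : l (h i) = WF \/ l (h i) = WVs by case: (l (h i)); auto.
    by have [_] := DF _ li; apply; exact: subvsP.
  by have := nw (h i); rewrite quiver_arrowV inE li !eqxx.
- move=> x x0; apply/dsumP => i; rewrite dsum0; apply/val_inj.
  by apply: (inj (fun i => vsval (x i))) => // j; exact: subvsP.
move=> y; have [u uU ->] := onto y.
exists (dsum_of (fun i => vsproj (U i) (u i) : band_rep i)).
by apply: eq_bigr => i _; rewrite dsum_ofE; apply/esym/vsprojK.
Qed.

Lemma band_nonzero (i : 'I_n) : exists u : band_rep i, u != 0.
Proof.
case: D => _ _ U0 _ _ _ _; exists (vsproj _ (vpick (U i))).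
apply: contra_neq (U0 i) => /(congr1 vsval); rewrite vsprojK ?memv_pick // linear0.
by move/eqP; rewrite vpick0 => /eqP.
Qed.

Lemma band_connected : connected_graph G.
Proof. exact: indecomposable_connected M_indec band_module_iso band_nonzero. Qed.

Lemma band_size : (0 < n)%N.
Proof.
case: D M_indec => _ _ _ _ onto _ _ [nz _]; rewrite lt0n; apply: contra_neq nz => n0.
apply/eqP; rewrite -subv0; apply/subvP => y _; have [u _ ->] := onto y.
by rewrite big1 ?mem0v // => i; have := leq_ltn_trans (leq0n i) (ltn_ord i); rewrite n0.
Qed.

Lemma band_indecomposable : indecomposable_rep band_rep.
Proof.
apply: (indecomposable_kraft_rep M_indec band_module_iso).
by exists (Ordinal band_size); exact: band_nonzero.
Qed.

(** Edges only join some [i] to [S i], so a connected quiver is a single orbit. *)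
Lemma band_orbit x y : fconnect S x y.
Proof.
have := band_connected x y; apply: connect_sub => i j /existsP[[]]; rewrite
  ?quiver_arrowF ?quiver_arrowV => /orP[] /and3P[_ _ /eqP->]; rewrite ?fconnect1 //;
  by rewrite fconnect_sym // fconnect1.
Qed.

Lemma band_circular : circular_graph G.
Proof.
have cT : #|vertex G| = n by exact: card_ord.
split; first by rewrite cT band_size.
pose x0 : 'I_n := Ordinal band_size.
have ord : order S x0 = #|vertex G|.
  by rewrite /order; apply: eq_card => y; rewrite !inE band_orbit.
pose v (k : 'I_#|vertex G|) : vertex G := iter k S x0.
have v_inj : injective v.
  move=> i j /(congr1 (findex S x0)); rewrite !findex_iter ?ord ?ltn_ord //.
  exact: val_inj.
have vb : bijective v by apply: inj_card_bij => //; exact: eq_leq (esym (card_ord _)).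
have vS i : v (ordS i) = S (v i).
  rewrite /v -iterS /=; have [iN|] := ltnP i.+1 #|vertex G|; first by rewrite modn_small.
  move=> h; have e : i.+1 = #|vertex G| by apply/eqP; rewrite eqn_leq h ltn_ord.
  by rewrite -[RHS]/(iter i.+1 S x0) e modnn -[in RHS]ord iter_order.
exists v, (l \o v); split=> //; rewrite quiver_converse.
apply/setP => x; apply/imsetP/imsetP => -[i _ ->]; last first.
  by exists (v i); rewrite ?inE // vS.
by have [w _ wK] := vb; exists (w i) => //; rewrite /= vS !wK.
Qed.

(** A repetition [m] would give a vertex and its [m]-th successor the same infinite word. *)
Lemma band_no_repetitions : ~ has_repetitions G.
Proof.
case: D => _ sep _ _ _ _ _ [v [l' [[vb arrG] [m [/andP[m0 mN] _ lm]]]]].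
have vl i : v (ordS i) = S (v i) /\ l' i = l (v i).
  have : (v i, v (ordS i), l' i) \in arrows (converse G).
    by rewrite arrG; apply/imsetP; exists i.
  by rewrite quiver_converse => /imsetP[j _ [-> -> ->]].
have vk k i : v (iter k (@ordS _) i) = iter k S (v i).
  by elim: k => //= k IH; rewrite (vl _).1 IH.
pose i0 : 'I_#|vertex G| := Ordinal (ltn_trans m0 mN).
have : v i0 = v (iter m (@ordS _) i0).
  apply: sep => k; rewrite -!vk -!(vl _).2 lm -!iterD addnC //.
move=> /(bij_inj vb)/(congr1 val); rewrite /= iter_ordS add0n modn_small // => e.
by have := m0; rewrite -e.
Qed.

End BandModule.

(** * Uniqueness for circular quivers *)

(** A circular quiver without repetitions, expressed without an enumeration of the vertices. *)
Variant cyclic_shift (G : lgraph label) (S : vertex G -> vertex G)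
    (l : vertex G -> letter) : Prop :=
  CyclicShift of
    arrows (converse G) = [set (x, S x, l x) | x : vertex G]
  & (forall x, iter #|vertex G| S x = x)
  & (forall x y, exists k, y = iter k S x)
  & (forall x y, (forall k, l (iter k S x) = l (iter k S y)) -> x = y).

(** If distinct vertices read the same word, their distance [d] and the number [n] of vertices are
    both periods of it, hence so is their gcd, which is a repetition because [0 < d < n]. *)
Lemma circular_shift (G : lgraph label) : circular_graph G -> ~ has_repetitions G ->
  exists S l, @cyclic_shift G S l.
Proof.
move=> [n0 [v [l [[w vK wK] arrG]]]] nrep; set n := #|vertex G| in n0 v l w vK wK arrG *.
pose S x := v (ordS (w x)); exists S, (l \o w).
have iterS' k x : iter k S x = v (iter k (@ordS n) (w x)).
  by elim: k => [|k IH]; rewrite ?wK // iterS IH /S vK.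
have ordn i : iter n (@ordS n) i = i.
  by apply/val_inj; rewrite /= iter_ordS modnDr modn_small.
have reach (i j : 'I_n) : iter (j + (n - i)) (@ordS n) i = j.
  apply/val_inj; rewrite /= iter_ordS addnCA subnKC; last exact: ltnW.
  by rewrite modnDr modn_small.
split.
- rewrite arrG; apply/setP => x; apply/imsetP/imsetP => -[i _ ->].
    by exists (v i) => //; rewrite /S /= vK.
  by exists (w i); rewrite //= wK.
- by move=> x; rewrite iterS' ordn wK.
- by move=> x y; exists (w y + (n - w x))%N; rewrite iterS' reach wK.
move=> x y sxy; apply: contrapT => xy; apply: nrep.
pose c k := l (iter k (@ordS n) (w x)).
pose d := ((w y + (n - w x)) %% n)%N.
have cn k q : c (k + q * n)%N = c k.
  rewrite /c iterD; congr (l (iter k _ _)); elim: q => // q IH.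
  by rewrite mulSn addnC iterD ordn IH.
have dE : iter d (@ordS n) (w x) = w y.
  rewrite -[RHS](reach (w x)); apply/val_inj.
  by rewrite /= !iter_ordS /d modnDmr.
have d0 : (0 < d)%N.
  rewrite lt0n; apply/eqP => d00; apply: xy; apply: (can_inj wK).
  by rewrite -dE d00.
have cd k q : c (k + q * d)%N = c k.
  elim: q => [|q IH]; rewrite ?addn0 // mulSn addnCA addnC -[RHS]IH /c iterD dE.
  have := sxy (k + q * d)%N; rewrite /= !iterS' !vK => ->.
  by [].
(* Bezout: adding a multiple of [n] to the gcd gives a multiple of [d]. *)
have cm k : c (k + gcdn d n)%N = c k.
  by case: (egcdnP n d0) => a b e _; rewrite -(cn _ b) -addnA [(gcdn _ _ + _)%N]addnC -e cd.
exists v, l; split; first by split=> //; exists w.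
exists (gcdn d n); split.
- rewrite gcdn_gt0 d0 /=; apply: leq_ltn_trans (ltn_pmod (w y + (n - w x)) n0).
  exact: dvdn_leq d0 (dvdn_gcdl d n).
- exact: dvdn_gcdr.
move=> i; have := cm (i + (n - w x))%N; rewrite /c [(_ + gcdn _ _)%N]addnC iterD.
by rewrite reach => ->.
Qed.

Lemma cyclic_shift_iter (G : lgraph label) S l : @cyclic_shift G S l ->
  forall k x, iter (k * #|vertex G|) S x = x.
Proof. by case=> _ h _ _; elim=> // k IH x; rewrite mulSn iterD IH h. Qed.

(** * Domains and kernels of words in a circular module *)

Section CircularModule.

Context {K : fieldType} {sigma tau : {rmorphism K -> K}}.
Context (tau_bij : bijective tau).
Context {G : kraft_quiver} {U : representation sigma tau G} (U_strict : strict_rep U).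
Context {S : vertex G -> vertex G} {l : vertex G -> letter} (SlP : cyclic_shift S l).
Let N := kraft_module U.

Let inA x y a : ((x, y, a) \in arrows (converse G)) = (y == S x) && (a == l x).
Proof.
case: SlP => -> _ _ _; apply/imsetP/andP => [[z _ [-> -> ->]]|[/eqP-> /eqP->]].
  by rewrite !eqxx.
by exists x.
Qed.

Let iterN := cyclic_shift_iter SlP.

Let n0 (x : vertex G) : (0 < #|vertex G|)%N.
Proof. by apply/card_gt0P; exists x. Qed.

Let S_inj : injective S.
Proof.
move=> x y xy; case: SlP => _ h _ _; rewrite -(h x) -(h y).
by rewrite -(prednK (n0 x)) !iterSr xy.
Qed.

Let S_inv (x : vertex G) : exists y, x = S y.
Proof.
case: SlP => _ h _ _; exists (iter #|vertex G|.-1 S x).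
by rewrite -iterS (prednK (n0 x)) h.
Qed.

Lemma shift_arrowF x : l x = WF -> (x, S x, LF) \in arrows G.
Proof. by move=> lx; rewrite converse_arrowF inA lx !eqxx. Qed.

Lemma shift_arrowV x : l x = WVs -> (S x, x, LV) \in arrows G.
Proof. by move=> lx; rewrite converse_arrowV inA lx !eqxx. Qed.

Lemma shift_opF x (z : dsum U) : l x = WF -> (graph_op LF z (S x) == 0) = (z x == 0).
Proof.
move=> /shift_arrowF h; pose e : arrow G := exist _ (x, S x, LF) h.
have -> : graph_op LF z (S x) = rep_map U e (z x) by exact: (graph_op_head e z).
by rewrite -(inj_eq (bij_inj (U_strict e))) linear0.
Qed.

Lemma shift_opF0 x (z : dsum U) : l x = WVs -> graph_op LF z (S x) = 0.
Proof.
move=> lx; apply: graph_op_head0 => y; rewrite converse_arrowF inA.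
by apply/negP => /andP[/eqP/S_inj <- ]; rewrite lx.
Qed.

Lemma shift_opV0 x (z : dsum U) : l x = WF -> graph_op LV z x = 0.
Proof.
by move=> lx; apply: graph_op_head0 => y; rewrite converse_arrowV inA lx andbF.
Qed.

Lemma shift_opV x (z : dsum U) : l x = WVs -> (graph_op LV z x == 0) = (z (S x) == 0).
Proof.
move=> /shift_arrowV h; pose e : arrow G := exist _ (S x, x, LV) h.
have -> : graph_op LV z x = rep_map U e (z (S x)) by exact: (graph_op_head e z).
by rewrite -(inj_eq (bij_inj (U_strict e))) linear0.
Qed.

Lemma shift_opV_in x (u : U x) : l x = WVs ->
  exists u' : U (S x), graph_op LV (dsum_in u') = dsum_in u.
Proof.
move=> /shift_arrowV h; pose e : arrow G := exist _ (S x, x, LV) h.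
have [r rK Kr] := U_strict e; exists (r u).
by rewrite (@graph_op_in _ _ _ _ U e (r u)) Kr.
Qed.

Definition supported (Z : pred (vertex G)) (z : dsum U) : Prop :=
  forall x, ~~ Z x -> z x = 0.

(** Strictness makes every [Dom] and [Ker] a sum of vertex spaces, so letters act on sets of
    vertices. A vertex with letter [WVs] emits no F-arrow, hence is unconstrained in a preimage
    under [F]. *)
Definition act_support a (Z : pred (vertex G)) : pred (vertex G) := fun x =>
  match a with
  | WF => (l x == WVs) || Z (S x)
  | WVs => (l x == WVs) && Z (S x)
  end.

Lemma mem_act_support a (X : {vspace N}) Z : (forall z, z \in X <-> supported Z z) ->
  forall z, z \in act a X <-> supported (act_support a Z) z.
Proof.
move=> XZ z; case: a.
  rewrite mem_actF XZ; split=> h x.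
    rewrite /= negb_or => /andP[lx /h /eqP].
    by rewrite shift_opF => [/eqP//|]; case: (l x) lx.
  have [y ->] := S_inv x => Zy; case ly: (l y); last exact: shift_opF0.
  by apply/eqP; rewrite shift_opF // h //= ly.
rewrite (mem_actV tau_bij); split=> [[y /XZ yZ ->] x|h].
  rewrite /= negb_and; case lx: (l x); first by move=> _; exact: shift_opV0.
  by move=> /= Zx; apply/eqP; rewrite shift_opV // yZ.
have ex x : exists y : N, supported Z y /\ graph_op LV y = dsum_in ((z : dsum U) x).
  have [zx|zx] := eqVneq ((z : dsum U) x) 0.
    by exists 0; split=> [y _|]; [exact: (dsum0 U)|rewrite zx !linear0].
  have : act_support WVs Z x by apply: contraNT zx => /h->.
  move=> /andP[/eqP lx ZSx]; have [u e] := shift_opV_in ((z : dsum U) x) lx.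
  exists (dsum_in u); split=> // y Zy; apply: dsum_in_neq.
  by apply: contraNneq Zy => <-.
pose y x := sval (cid (ex x)).
exists (\sum_x y x); last first.
  rewrite [z in LHS](dsum_inE (z : dsum U)) linear_sum; apply: eq_bigr => x _.
  by rewrite /y; case: cid => ? [].
apply: rpred_sum => x _; apply/XZ; rewrite /y; by case: cid => ? [].
Qed.

Definition pre_support s Z := foldr act_support Z s.

Lemma mem_dom_support s z : z \in pre s (fullv : {vspace N}) <-> supported (pre_support s predT) z.
Proof.
elim: s z => [|a s IH] z; last exact: mem_act_support.
by split=> [_ x //|_]; rewrite memvf.
Qed.

Lemma mem_ker_support s z : z \in pre s (0%VS : {vspace N}) <-> supported (pre_support s pred0) z.
Proof.
elim: s z => [|a s IH] z; last exact: mem_act_support.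
rewrite memv0; split=> [/eqP-> x _|h]; first exact: (dsum0 U).
by apply/eqP/dsumP => x; rewrite h // dsum0.
Qed.

Definition letters k x := mkseq (fun i => l (iter i S x)) k.

(** A letter keeps a difference between two supports only at vertices carrying that letter, where it
    looks at the next vertex. *)
Lemma support_step s x :
  (pre_support s predT x && ~~ pre_support s pred0 x) = (s == letters (size s) x).
Proof.
elim: s x => [|a s IH] x; first by rewrite eqxx.
have -> : letters (size (a :: s)) x = l x :: letters (size s) (S x).
  rewrite /letters /mkseq /= -add1n iotaDl -map_comp; congr (_ :: _).
  by apply: eq_map => i; rewrite -iterSr.
rewrite eqseq_cons -IH /=.
by case: a; rewrite /=; case: (l x) => //=; rewrite ?andbF ?andbT.
Qed.

Lemma strict_nonzero : nonzero_rep U -> forall x, exists u : U x, u != 0.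
Proof.
case=> x0 [u0 nz] x; case: SlP => _ _ reach _; have [k ->] := reach x0 x.
elim: k => [|k [u unz]]; first by exists u0.
case ly: (l (iter k S x0)).
  pose e : arrow G := exist _ (_, S (iter k S x0), LF) (shift_arrowF ly).
  exists (rep_map U e u).
  by apply: contra_neq unz => h; apply: (bij_inj (U_strict e)); rewrite h linear0.
have [u' e] := shift_opV_in u ly; exists u'.
apply: contra_neq unz => u'0.
by rewrite -(dsum_in_eq u) -e u'0 !linear0; exact: (dsum0 U).
Qed.

End CircularModule.

Arguments letters {G} S l k x.
Arguments pre_support {G} S l s Z x.

Section CircularMatch.

Context {K : fieldType} {sigma tau : {rmorphism K -> K}}.
Context (tau_bij : bijective tau).
Context {G G' : kraft_quiver}.
Context {U : representation sigma tau G} {U' : representation sigma tau G'}.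
Context (U_strict : strict_rep U) (U'_strict : strict_rep U').
Context {S : vertex G -> vertex G} {l : vertex G -> letter} (SlP : cyclic_shift S l).
Context {S' : vertex G' -> vertex G'} {l' : vertex G' -> letter}.
Context (SlP' : cyclic_shift S' l').
Let N := kraft_module U.
Let N' := kraft_module U'.
Context (f : {linear N -> N'}) (f_bij : bijective f).
Context (fF : forall x, f (opF x) = opF (f x)) (fV : forall x, f (opV x) = opV (f x)).

Let dom_f s (z : N) : z \in pre s fullv <-> f z \in pre s fullv.
Proof. by apply: (iso_pre tau_bij s f_bij fF fV) => x; rewrite !memvf. Qed.

Let ker_f s (z : N) : z \in pre s 0%VS <-> f z \in pre s 0%VS.
Proof.
apply: (iso_pre tau_bij s f_bij fF fV) => x.
by rewrite !memv0 -(inj_eq (bij_inj f_bij)) linear0.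
Qed.

(** The product of the numbers of vertices is a period of both words. *)
Lemma letters_agree x y :
  (forall k, (k < #|vertex G| * #|vertex G'|)%N -> l (iter k S x) = l' (iter k S' y)) ->
  forall k, l (iter k S x) = l' (iter k S' y).
Proof.
set m := (_ * _)%N => h k.
have m0 : (0 < m)%N by rewrite muln_gt0; apply/andP; split; apply/card_gt0P; [exists x|exists y].
have xm q : iter (q * m) S x = x by rewrite /m mulnCA mulnC (cyclic_shift_iter SlP).
have ym q : iter (q * m) S' y = y by rewrite /m mulnA (cyclic_shift_iter SlP').
by rewrite (divn_eq k m) addnC !iterD xm ym h // ltn_mod.
Qed.

Lemma in_dom x (u : U x) s : s = letters S l (size s) x ->
  (dsum_in u : N) \in pre s fullv.
Proof.
move=> e; apply/(mem_dom_support tau_bij U_strict SlP) => y Zy; apply: dsum_in_neq.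
apply: contraNneq Zy => <-.
by have /andP[] : pre_support S l s predT x && ~~ pre_support S l s pred0 x
  by rewrite support_step -e.
Qed.

Lemma ker_coord0 x (z : N) s : s = letters S l (size s) x ->
  z \in pre s 0%VS -> (z : dsum U) x = 0.
Proof.
move=> e /(mem_ker_support tau_bij U_strict SlP) /(_ x); apply.
by have /andP[] : pre_support S l s predT x && ~~ pre_support S l s pred0 x
  by rewrite support_step -e.
Qed.

Lemma dom_coord0 s (z : N') : z \in pre s fullv ->
  (forall y, s = letters S' l' (size s) y -> (z : dsum U') y = 0) ->
  z \in pre s 0%VS.
Proof.
move=> /(mem_dom_support tau_bij U'_strict SlP') zs z0.
apply/(mem_ker_support tau_bij U'_strict SlP') => y ny.
have [Zy|/zs//] := boolP (pre_support S' l' s predT y).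
by apply: z0; apply/eqP; rewrite -support_step Zy ny.
Qed.

(** If no vertex of [G'] read the word [s] of [x], then [Dom] and [Ker] of [s] would agree in [N'],
    so [u] would lie in the kernel of [s], whose coordinate at [x] is 0. *)
Lemma letters_match x (u : U x) : u != 0 ->
  exists y, forall k, l (iter k S x) = l' (iter k S' y).
Proof.
move=> u0; pose m := (#|vertex G| * #|vertex G'|)%N.
pose s := letters S l m x; have sm : size s = m by rewrite size_mkseq.
have [[y e]|no] := pselect (exists y, s = letters S' l' m y).
  exists y; apply: letters_agree => k km; have := congr1 (nth WF ^~ k) e.
  by rewrite !nth_mkseq.
case/eqP: u0; rewrite -(dsum_in_eq u).
apply: (@ker_coord0 x (dsum_in u) s); first by rewrite sm.
apply/ker_f/dom_coord0; first by apply/dom_f/in_dom; rewrite sm.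
by move=> y; rewrite sm => e; case: no; exists y.
Qed.

End CircularMatch.

Lemma dsumB (K : fieldType) (I : finType) (U : I -> vectType K) (x y : dsum U) i :
  (x - y) i = x i - y i.
Proof. by rewrite dsumD -scaleN1r dsumZ scaleN1r. Qed.

Section CircularUnique.

Context {K : fieldType} {sigma tau : {rmorphism K -> K}}.
Context (tau_bij : bijective tau).

(** Matching infinite words gives the bijection [h] of the vertices. For [s] long enough to single
    out [v], the quotient of [Dom] by [Ker] of [s] is [U v] on one side and [U' (h v)] on the other,
    and the module isomorphism preserves it. *)
Lemma circular_unique (M : twisted_module sigma tau) (G G' : kraft_quiver)
    (U : representation sigma tau G) (U' : representation sigma tau G') :
  circular_graph G -> ~ has_repetitions G -> strict_rep U -> nonzero_rep U ->
  isomorphic_modules M (kraft_module U) ->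
  circular_graph G' -> ~ has_repetitions G' -> strict_rep U' -> nonzero_rep U' ->
  isomorphic_modules M (kraft_module U') ->
  isomorphic_reps U U'.
Proof.
move=> Gc Gn Us Unz MU Gc' Gn' Us' Unz' MU'.
have [S [l Sl]] := circular_shift Gc Gn; have [S' [l' Sl']] := circular_shift Gc' Gn'.
have [f [fb fF fV]] := isomorphic_modules_trans (isomorphic_modules_sym MU) MU'.
have [g [fK gK]] := bijective_linear_inv fb.
have gb : bijective g by exists f.
have gF x : g (opF x) = opF (g x) by apply: (can_inj fK); rewrite fF !gK.
have gV x : g (opV x) = opV (g x) by apply: (can_inj fK); rewrite fV !gK.
have ex x : exists y, forall k, l (iter k S x) = l' (iter k S' y).
  have [u u0] := strict_nonzero Us Sl Unz x.
  exact: (letters_match tau_bij Us Us' Sl Sl' fb fF fV u0).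
have ex' y : exists x, forall k, l' (iter k S' y) = l (iter k S x).
  have [u u0] := strict_nonzero Us' Sl' Unz' y.
  exact: (letters_match tau_bij Us' Us Sl' Sl gb gF gV u0).
pose h x := sval (cid (ex x)); pose h' y := sval (cid (ex' y)).
have hP x k : l (iter k S x) = l' (iter k S' (h x)) := svalP (cid (ex x)) k.
have hP' y k : l' (iter k S' y) = l (iter k S (h' y)) := svalP (cid (ex' y)) k.
have [arrG _ _ sep] := Sl; have [arrG' _ _ sep'] := Sl'.
have hK : cancel h h' by move=> x; apply: sep => k; rewrite -hP' -hP.
have hK' : cancel h' h by move=> y; apply: sep' => k; rewrite -hP -hP'.
have hb : bijective h by exists h'.
have hS x : h (S x) = S' (h x).
  by apply: sep' => k; rewrite -hP -!iterSr -hP.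
have hl x : l' (h x) = l x by rewrite [RHS](hP x 0%N).
have hE x y a : ((h x, h y, a) \in arrows (converse G')) = ((x, y, a) \in arrows (converse G)).
  rewrite arrG arrG'; apply/imsetP/imsetP => -[z _ []].
    move=> e ey ->; exists x => //; congr (_, _, _).
      by apply: (can_inj hK); rewrite hS e.
    by rewrite -hl e.
  by move=> -> -> ->; exists (h z); rewrite // hS hl.
have hA x y a : ((h x, h y, a) \in arrows G') = ((x, y, a) \in arrows G).
  by case: a; rewrite ?converse_arrowF ?converse_arrowV hE.
pose F : graph_iso G G' := GraphIso hb hA.
exists F.
(* [f] need not respect the decompositions by vertices; only its diagonal blocks are kept. *)
pose phi v (u : U v) : pullback_rep F U' v := (f (dsum_in u) : dsum U') (h v).
have phiL v : linear (@phi v).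
  by move=> a u w; rewrite /phi !linearP; rewrite (dsumD (U := rep_space U')) dsumZ.
pose Phi v : {linear U v -> pullback_rep F U' v} := HB.pack (@phi v)
  (GRing.isLinear.Build K (U v) (pullback_rep F U' v) _ _ (phiL v)).
exists Phi.
pose m := (#|vertex G| * #|vertex G'|)%N.
have uniq' v y : letters S l m v = letters S' l' m y -> y = h v.
  move=> e; apply: sep' => k; rewrite -hP; apply/esym.
  apply: (letters_agree Sl Sl') => {}k km.
  by have := congr1 (nth WF ^~ k) e; rewrite !nth_mkseq.
have eqw v : letters S l m v = letters S' l' m (h v).
  by apply: eq_map => k; exact: hP.
have uniq v x : letters S' l' m (h v) = letters S l m x -> x = v.
  by rewrite -eqw (eqw x) => /uniq'/(can_inj hK).
split=> [v|e u] /=.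
  pose s := letters S l m v; have sm : size s = m by rewrite size_mkseq.
  have dom_f z : z \in pre s fullv <-> f z \in pre s fullv.
    by apply: (iso_pre tau_bij s fb fF fV) => x; rewrite !memvf.
  have ker_f z : z \in pre s 0%VS <-> f z \in pre s 0%VS.
    apply: (iso_pre tau_bij s fb fF fV) => x.
    by rewrite !memv0 -(inj_eq (bij_inj fb)) linear0.
  have ker0 (z : kraft_module U) : z \in pre s 0%VS -> (z : dsum U) v = 0.
    by apply: (ker_coord0 tau_bij Us Sl); rewrite sm.
  have ker0' (z : kraft_module U') : z \in pre s 0%VS -> (z : dsum U') (h v) = 0.
    by apply: (ker_coord0 tau_bij Us' Sl'); rewrite sm /s eqw.
  have domv (u : U v) : (dsum_in u : kraft_module U) \in pre s fullv.
    by apply: (in_dom tau_bij Us Sl); rewrite sm.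
  have domv' (u : U' (h v)) : (dsum_in u : kraft_module U') \in pre s fullv.
    by apply: (in_dom tau_bij Us' Sl'); rewrite sm /s eqw.
  have kill (z : kraft_module U) : z \in pre s fullv -> (z : dsum U) v = 0 -> z \in pre s 0%VS.
    move=> zs z0; apply: (dom_coord0 tau_bij Us Sl zs) => y; rewrite sm /s eqw.
    by move=> /uniq->.
  have kill' (z : kraft_module U') : z \in pre s fullv -> (z : dsum U') (h v) = 0 -> z
      \in pre s 0%VS.
    move=> zs z0; apply: (dom_coord0 tau_bij Us' Sl' zs) => y; rewrite sm.
    by move=> /uniq'->.
  apply: inj_onto_bijective => [u w|u'].
    move=> uw; have e : phi v u = phi v w by exact: uw.
    rewrite -[u]dsum_in_eq -[w]dsum_in_eq; apply/eqP; rewrite -subr_eq0 -dsumB.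
    apply/eqP/ker0/ker_f/kill'; first by rewrite linearB rpredB //; exact/dom_f.
    by rewrite linearB dsumB -[LHS]/(phi v u - phi v w) e subrr.
  exists ((g (dsum_in u') : dsum U) v).
  set z := g (dsum_in u'); set y : kraft_module U := dsum_in ((z : dsum U) v).
  have zs : z \in pre s fullv by apply/dom_f; rewrite gK.
  have yz : y - z \in pre s 0%VS.
    apply: kill; first exact: rpredB (domv _) zs.
    by rewrite dsumB dsum_in_eq subrr.
  move: yz => /ker_f/ker0'; rewrite linearB gK dsumB dsum_in_eq => /eqP.
  by rewrite subr_eq0 => /eqP.
have fop a (z : kraft_module U) : f (graph_op a z) = graph_op a (f z : dsum U').
  by case: a; [exact: fF|exact: fV].
rewrite /phi -graph_op_in fop.
exact: (graph_op_head (iso_arrow F e) (f (dsum_in u) : dsum U')).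
Qed.

End CircularUnique.

Theorem theorem2 (K : fieldType) (sigma tau : {rmorphism K -> K})
    (sigma_bij : bijective sigma) (tau_bij : bijective tau)
    (M : twisted_module sigma tau) (M_indec : indecomposable_module M) :
  ((first_kind M \/ second_kind M) /\ ~ (first_kind M /\ second_kind M)) /\
  (first_kind M ->
    let P (G : kraft_quiver) : Prop :=
      [/\ connected_graph G, linear_graph G
        & isomorphic_modules M (kraft_module (trivial_rep sigma tau G))] in
    exists G : kraft_quiver,
      P G /\ forall G' : kraft_quiver, P G' -> isomorphic_graphs G G') /\
  (second_kind M ->
    let P (G : kraft_quiver) (U : representation sigma tau G) : Prop :=
      [/\ connected_graph G, circular_graph G & ~ has_repetitions G] /\
      [/\ strict_rep U, indecomposable_rep U
        & isomorphic_modules M (kraft_module U)] in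
    exists (G : kraft_quiver) (U : representation sigma tau G),
      P G U /\
      forall (G' : kraft_quiver) (U' : representation sigma tau G'),
        P G' U' -> isomorphic_reps U U').
Proof.
have nz : (fullv : {vspace M}) != 0%VS by case: M_indec.
have excl := kinds_exclusive tau_bij nz.
have string : ~~ (kerF <= (imV : {vspace M}))%VS -> first_kind M /\
    exists G : kraft_quiver, [/\ connected_graph G, linear_graph G
      & isomorphic_modules M (kraft_module (trivial_rep sigma tau G))].
  move=> /(string_existence sigma_bij tau_bij M_indec)[s [gs ds MG]].
  by split; [exact: first_kind_gapped gs ds|exists (string_quiver s)].
split; [split=> //|split].
- have [ex|/string[]] := boolP (kerF <= (imV : {vspace M}))%VS; last by left.
  by right; exact: second_kind_exact.
(* [Ker F = V M] would make [M] of the second kind as well. *)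
- move=> fk P; have [ex|/string[_ [G [cG lG MG]]]] := boolP (kerF <= (imV : {vspace M}))%VS.
    by case: excl; split=> //; exact: second_kind_exact.
  exists G; split=> // G' [_ lG' MG'].
  exact: string_unique lG MG lG' MG'.
move=> sk P; have [ex|/string[fk _]] := boolP (kerF <= (imV : {vspace M}))%VS; last first.
  by case: excl.
have [n [S [l [U D]]]] := cyclic_decomposition_ex sigma_bij tau_bij ex.
have cG := band_circular M_indec D; have nG := band_no_repetitions (D := D).
have sU := band_strict (D := D); have iU := band_indecomposable M_indec D.
have MU := band_module_iso D.
exists (quiver setT l (cyclic_decomposition_inj D)), (band_rep D); split.
  by split; split=> //; exact: (band_connected M_indec (D := D)).
move=> G' U' [[_ cG' nG'] [sU' [nzU' _] MU']].
exact: (circular_unique tau_bij cG nG sU (proj1 iU) MU cG' nG' sU' nzU' MU').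
Qed.
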